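(* Let $G$ be a hypercentral group containing a finite contranormal subgroup. Then: (i) $G=VC$, where $V$ is a normal divisible abelian subgroup of $G$ and $C$ is a finite contranormal subgroup of $G$; (ii) $\Pi(G)=\Pi(C)$; in particular $\Pi(G)$ is finite; (iii) $V$ has a family $\{D_\mu \mid \mu\in M\}$ of $G$-invariant $G$-quasifinite subgroups such that $V=\langle D_\mu \mid \mu\in M\rangle$; (iv) $[D_\mu, C]=D_\mu$ for all $\mu\in M$; in particular $[V,C]=V$.
   Context: A subgroup $H$ of $G$ is contranormal in $G$ if its normal closure $H^G$ equals $G$. $\Pi(X)$ denotes the set of primes $p$ such that $X$ contains an element of order $p$. An infinite normal abelian subgroup $A$ of a group $G$ is called $G$-quasifinite if every proper $G$-invariant subgroup of $A$ is finite. *)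

(* Defs.v *)
From mathcomp Require Import all_boot.
From Stdlib Require Import List.


Record AbsGroup := {
  gcar :> Type;
  gmul : gcar -> gcar -> gcar;
  gone : gcar;
  ginv : gcar -> gcar;
  gmulA : forall x y z, gmul x (gmul y z) = gmul (gmul x y) z;
  gmul1 : forall x, gmul gone x = x;
  gmulV : forall x, gmul (ginv x) x = gone
}.

Section GroupDefs.
Variable G : AbsGroup.

Definition gsub := G -> Prop.

Fixpoint gpow (x : G) (n : nat) : G :=
  match n with 0 => gone G | S k => gmul G x (gpow x k) end.

Definition conj (x g : G) : G := gmul G (ginv G g) (gmul G x g).
Definition comm (x y : G) : G :=
  gmul G (ginv G x) (gmul G (ginv G y) (gmul G x y)).

Definition gsubset (A B : gsub) : Prop := forall x, A x -> B x.
Definition seteq (A B : gsub) : Prop := forall x, A x <-> B x.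
Definition whole : gsub := fun _ => True.

Definition subgroup (H : gsub) : Prop :=
  H (gone G) /\ (forall x y, H x -> H y -> H (gmul G x y)) /\
  (forall x, H x -> H (ginv G x)).

Definition normal (H : gsub) : Prop :=
  subgroup H /\ forall x g, H x -> H (conj x g).

Definition finite_set (H : gsub) : Prop := exists l : list G, forall x, H x -> In x l.

Definition abelian (H : gsub) : Prop :=
  forall x y, H x -> H y -> gmul G x y = gmul G y x.

Definition divisible (H : gsub) : Prop :=
  forall x n, H x -> 0 < n -> exists y, H y /\ gpow y n = x.

Definition gen (S : gsub) : gsub :=
  fun x => forall H, subgroup H -> gsubset S H -> H x.

Definition normal_closure (H : gsub) : gsub :=
  fun x => forall N, normal N -> gsubset H N -> N x.

Definition contranormal (H : gsub) : Prop :=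
  subgroup H /\ seteq (normal_closure H) whole.

Definition commsub (A B : gsub) : gsub :=
  gen (fun x => exists a b, A a /\ B b /\ x = comm a b).

Definition prodset (A B : gsub) : gsub :=
  fun x => exists a b, A a /\ B b /\ x = gmul G a b.

Definition Pi (X : gsub) : nat -> Prop :=
  fun p => prime p /\ exists x, X x /\ x <> gone G /\ gpow x p = gone G.

Definition quasifinite (A : gsub) : Prop :=
  normal A /\ abelian A /\ ~ finite_set A /\
  forall B, normal B -> gsubset B A -> (exists x, A x /\ ~ B x) -> finite_set B.

(* Transfinite upper central series, as a least fixed point:
   Z_0 = 1, Z_{a+1} = {x | [x,g] in Z_a for all g}, unions at limits.
   [hypercentre x] means x lies in some term Z_a. *)
Inductive hypercentre : G -> Prop :=
  | hyc_one : hypercentre (gone G)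
  | hyc_step x : (forall g, hypercentre (comm x g)) -> hypercentre x.

Definition hypercentral : Prop := forall x : G, hypercentre x.

End GroupDefs.

Arguments gpow {G}.
Arguments conj {G}.
Arguments comm {G}.
Arguments gsubset {G}.
Arguments seteq {G}.
Arguments subgroup {G}.
Arguments normal {G}.
Arguments finite_set {G}.
Arguments abelian {G}.
Arguments divisible {G}.
Arguments gen {G}.
Arguments normal_closure {G}.
Arguments contranormal {G}.
Arguments commsub {G}.
Arguments prodset {G}.
Arguments Pi {G}.
Arguments quasifinite {G}.
Arguments hypercentre {G}.

(* Main.v *)
(** Finite quotients of a hypercentral group [G] are nilpotent, so a finite
    contranormal subgroup [K] supplements every normal subgroup of finite
    index; hence there is a least such subgroup [V], and [G = V K].  Modulo its
    largest normal torsion subgroup, [G] has a torsion-free centre, to which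
    [K], and therefore [G], has no nontrivial morphism: so [G] is torsion, with
    the primes of [K].  Having no proper subgroup of finite index, [V] is then
    abelian and divisible.  The [K]-module [V] is the sum of invariant divisible
    p-groups of finite rank, generated by the conjugates of a Pruefer group; a
    Maschke argument splits these, up to finite intersections, into quasifinite
    ones.  Finally [V = [V, K]] is killed by the norm of [K], which acts as
    multiplication by [|K|] on fixed points, whence [[D, K] = D]. *)

From Stdlib Require Import List.
From HB Require Import structures.
From mathcomp Require Import all_boot ssralg.
From mathcomp Require Import boolp classical_sets.
Require Import Defs.

Set Implicit Arguments.
Unset Strict Implicit.
Unset Printing Implicit Defensive.

Import GRing.Theory.

(** * Abelian groups and Pruefer chains *)

Section Listed.

(** Every prime that occurs in [V] also occurs in [K], so Maschke's average cannot be divided by the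
    order of [K]. Splittings are therefore made up to a positive multiplier [m]: multiplication by
    [m] is onto on a divisible group and has a finite kernel on a divisible [p]-group of finite
    rank. Rank and index are never numbers here; each descent counts the entries of a fixed list
    satisfying a shrinking predicate (elements killed by [p], classes not inside a subgroup,
    elements of [K]). *)

Definition listed (T : eqType) (X : T -> Prop) :=
  exists l : seq T, forall x, X x -> x \in l.

Lemma listed_sub (T : eqType) (X Y : T -> Prop) :
  (forall x, X x -> Y x) -> listed Y -> listed X.
Proof. by move=> XY [l Yl]; exists l => x /XY/Yl. Qed.

Lemma listed_bigU (T U : eqType) (L : seq U) (X : U -> T -> Prop) :
  (forall q, q \in L -> listed (X q)) ->
  listed (fun x => exists2 q, q \in L & X q x).
Proof.
elim: L => [|q L IH] XL; first by exists [::] => x [].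
have [l1 h1] := XL q (mem_head _ _).
have [|l2 h2] := IH; first by move=> r rL; apply: XL; rewrite inE rL orbT.
exists (l1 ++ l2) => x [r]; rewrite inE mem_cat => /orP[/eqP-> /h1-> //|rL Xr].
by rewrite (h2 x) ?orbT //; exists r.
Qed.

Definition pcount (T : Type) (P : T -> Prop) (l : seq T) :=
  count (fun x => `[< P x >]) l.

Lemma ltn_pcount (T : eqType) (P Q : T -> Prop) (l : seq T) x :
  (forall y, P y -> Q y) -> x \in l -> Q x -> ~ P x ->
  pcount P l < pcount Q l.
Proof.
move=> PQ + Qx nPx; have le s : pcount P s <= pcount Q s.
  by apply: sub_count => y /asboolP/PQ ?; apply/asboolP.
elim: l => // y l IH; rewrite inE => /orP[/eqP<-|/IH lt] /=.
  by rewrite (asboolT Qx) (asboolF nPx) ltnS le.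
rewrite -addnS leq_add //.
by case: asboolP => [/PQ/asboolT->|].
Qed.

End Listed.

Section AbelianGroups.
Variable V : zmodType.
Implicit Types (B D E X Y : V -> Prop) (x y v : V) (p : nat).
Local Open Scope ring_scope.

Definition asubg B := B 0 /\ forall x y, B x -> B y -> B (x - y).

Lemma asubgN B x : asubg B -> B x -> B (- x).
Proof. by case=> B0 BB Bx; rewrite -sub0r; apply: BB. Qed.

Lemma asubgD B x y : asubg B -> B x -> B y -> B (x + y).
Proof. by move=> sB Bx By; rewrite -[y]opprK; apply: sB.2 => //; apply: asubgN. Qed.

Lemma asubgMn B x n : asubg B -> B x -> B (x *+ n).
Proof.
move=> sB Bx; elim: n => [|n IH]; first by rewrite mulr0n; case: sB.
by rewrite mulrS; apply: asubgD.
Qed.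

Lemma asubg_sum B (I : eqType) (s : seq I) (F : I -> V) :
  asubg B -> (forall i, i \in s -> B (F i)) -> B (\sum_(i <- s) F i).
Proof.
move=> sB BF; rewrite big_seq; elim/big_ind: _ => //; first by case: sB.
by move=> x y; apply: asubgD.
Qed.

Lemma asubg_zero : asubg (fun x => x = 0).
Proof. by split=> // x y -> ->; rewrite subr0. Qed.

Definition addset B X x := exists b y, [/\ B b, X y & x = b + y].

Lemma asubg_add B X : asubg B -> asubg X -> asubg (addset B X).
Proof.
move=> sB sX; split; first by exists 0, 0; rewrite addr0; case: sB; case: sX.
move=> _ _ [b [y [Bb Xy ->]]] [b' [y' [Bb' Xy' ->]]].
by exists (b - b'), (y - y'); rewrite addrACA opprD; split=> //; [apply: sB.2|apply: sX.2].
Qed.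

Lemma addsetl B X x : asubg X -> B x -> addset B X x.
Proof. by move=> sX Bx; exists x, 0; rewrite addr0; split=> //; case: sX. Qed.

Lemma addsetr B X x : asubg B -> X x -> addset B X x.
Proof. by move=> sB Xx; exists 0, x; rewrite add0r; split=> //; case: sB. Qed.

Lemma listed_coset B X : (forall x y, X x -> X y -> B (x - y)) -> listed B -> listed X.
Proof.
move=> XB [l Bl]; case: (pselect (exists x, X x)) => [[x0 Xx0]|nX].
  exists [seq b + x0 | b <- l] => x Xx; apply/mapP; exists (x - x0); last by rewrite subrK.
  by apply/Bl/XB.
by exists [::] => x Xx; case: nX; exists x.
Qed.

Definition torsion := forall v : V, exists2 n, (0 < n)%N & v *+ n = 0.

Lemma listed_exponent X : torsion -> listed X ->
  exists2 n, (0 < n)%N & forall x, X x -> x *+ n = 0.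
Proof.
move=> tV [l Xl]; have [n n0 hn] : exists2 n, (0 < n)%N & forall x, x \in l -> x *+ n = 0.
  elim: l {Xl} => [|a l [n n0 IH]]; first by exists 1%N.
  have [k k0 ak] := tV a; exists (k * n)%N; first by rewrite muln_gt0 k0.
  move=> x; rewrite inE => /orP[/eqP->|/IH xn].
    by rewrite mulrnA ak mul0rn.
  by rewrite mulnC mulrnA xn mul0rn.
by exists n => // x /Xl/hn.
Qed.

Lemma mulrn_coprime x q n : x *+ n = 0 -> coprime q n -> exists c, x *+ (q * c) = x.
Proof.
move=> xn; case: q => [|q] cqn.
  by exists 0%N; move: cqn xn; rewrite /coprime gcd0n => /eqP->; rewrite mulr1n.
case: (@egcdnP q.+1 n) => // c d e _; exists c.
by rewrite mulnC e (eqP cqn) mulrnDr mulr1n mulnC mulrnA xn mul0rn add0r.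
Qed.

Definition adivisible B := forall x n, B x -> (0 < n)%N -> exists2 y, B y & y *+ n = x.
Definition pdivisible p B := forall x, B x -> exists2 y, B y & y *+ p = x.
Definition pprimary p x := exists j, x *+ p ^ j = 0.

Lemma prime_adivisible B : (forall p, prime p -> pdivisible p B) -> adivisible B.
Proof.
move=> dB x n Bx; elim/ltn_ind: n x Bx => n IH x Bx n0.
case: (ltngtP n 1) => [|n1|->]; first by rewrite ltnS leqn0 => /eqP n00; rewrite n00 in n0.
  have pp := pdiv_prime n1; have pn := pdiv_dvd n.
  have lt : (n %/ pdiv n < n)%N by rewrite ltn_Pdiv // prime_gt1.
  have [|y By <-] := IH _ lt x Bx; first by rewrite divn_gt0 ?pdiv_gt0 // dvdn_leq.
  have [z Bz <-] := dB _ pp _ By; exists z => //.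
  by rewrite -mulrnA mulnC divnK.
by exists x.
Qed.

Lemma pprimary_adivisible p B : prime p -> asubg B ->
  (forall x, B x -> pprimary p x) -> pdivisible p B -> adivisible B.
Proof.
move=> pp sB tB dB; apply: prime_adivisible => q qp x Bx.
case: (eqVneq q p) => [->|qNp]; first exact: dB.
have [j xj] := tB _ Bx.
have [|c xc] := mulrn_coprime (q := q) xj; first by rewrite coprimeXr // prime_coprime // dvdn_prime2.
by exists (x *+ c); [apply: asubgMn|rewrite -mulrnA mulnC].
Qed.

Lemma adivisible_exponent B n : adivisible B -> (0 < n)%N ->
  (forall x, B x -> x *+ n = 0) -> forall x, B x -> x = 0.
Proof. by move=> dB n0 Bn x Bx; have [y /Bn yn <-] := dB x n Bx n0. Qed.

(** Induction on the exponent: [x *+ p] is [y *+ p] with [y] in [X], so [x - y] is in the socle.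
    Hence a proper divisible subgroup misses a socle element, which makes socle counts decrease. *)
Lemma pdivisible_socle p X Y : asubg X -> (forall x, X x -> Y x) -> asubg Y ->
  (forall x, Y x -> pprimary p x) -> pdivisible p X ->
  (forall x, Y x -> x *+ p = 0 -> X x) -> forall x, Y x -> X x.
Proof.
move=> sX XY sY tY dX soc x Yx; have [j] := tY _ Yx; elim: j x Yx => [|j IH] x Yx.
  by rewrite mulr1n => ->; case: sX.
rewrite expnS mulrnA => /(IH _ (asubgMn p sY Yx))/dX[y Xy yp].
rewrite -[x](subrK y); apply: asubgD => //; apply: soc.
  by apply: sY.2 => //; apply: XY.
by rewrite mulrnBl yp subrr.
Qed.

Section Chain.
Variables (p : nat) (e : nat -> V).
Hypotheses (pp : prime p) (ch : forall i, e i.+1 *+ p = e i) (te : pprimary p (e 0)).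

Lemma chainD i j : e (i + j) *+ p ^ j = e i.
Proof. by elim: j => [|j IH]; rewrite ?addn0 // addnS expnS mulrnA ch. Qed.

Lemma chain_pprimary i : pprimary p (e i).
Proof. by have [j ej] := te; exists (i + j)%N; rewrite expnD mulrnA -{1}[i]add0n chainD. Qed.

(* For a nonzero chain this is a Pruefer group. *)
Definition chain_span x := exists i k, x = e i *+ k.

Lemma mem_chain_span i : chain_span (e i).
Proof. by exists i, 1%N. Qed.

Lemma chain_span_subg : asubg chain_span.
Proof.
split; first by exists 0%N, 0%N.
move=> _ _ [i [k ->]] [j [l ->]].
rewrite -(chainD i j) -(chainD j i) addnC -!mulrnA.
have [t et] := chain_pprimary (j + i).
set f := e _ in et *; set a := (_ * k)%N; set b := (_ * l)%N.
(* Multipliers are natural numbers, so [- b] becomes [b * (p ^ t).-1], where [p ^ t] kills [f]. *)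
exists (j + i)%N, (a + b * (p ^ t).-1)%N; rewrite mulrnDr; congr (_ + _).
apply/esym/eqP; rewrite -addr_eq0 -mulrnDr -mulnSr prednK ?expn_gt0 ?prime_gt0 //.
by rewrite mulnC mulrnA et mul0rn.
Qed.

Lemma chain_span_pprimary x : chain_span x -> pprimary p x.
Proof.
move=> [i [k ->]]; have [j ej] := chain_pprimary i.
by exists j; rewrite mulrnAC ej mul0rn.
Qed.

Lemma chain_span_pdivisible : pdivisible p chain_span.
Proof.
move=> _ [i [k ->]]; exists (e i.+1 *+ k); first by exists i.+1, k.
by rewrite mulrnAC ch.
Qed.


Lemma chain_mulrn_listed i : listed (fun y => exists k, y = e i *+ k).
Proof.
have [t et] := chain_pprimary i.
exists [seq e i *+ k | k <- iota 0 (p ^ t)] => _ [k ->]; apply/mapP.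
exists (k %% p ^ t)%N; first by rewrite mem_iota ltn_pmod // expn_gt0 prime_gt0.
by rewrite {1}(divn_eq k (p ^ t)) mulrnDr mulnC mulrnA et mul0rn add0r.
Qed.

(** Subgroups of a Pruefer group form a chain. If [x] is not a multiple of [e i], some [p]-power
    multiple of [x] is [e i *+ u] with [u] prime to [p], and inverting [u] puts [e i] in [Y]. *)
Lemma chain_span_cap Y i x : asubg Y -> ~ Y (e i) ->
  Y x -> chain_span x -> exists k, x = e i *+ k.
Proof.
move=> sY Yi Yx [j [k xE]].
have xK : x = e (i + j) *+ (p ^ i * k) by rewrite mulrnA addnC chainD.
move: (p ^ i * k)%N xK => K {xE} xE.
case: (boolP (p ^ j %| K)) => [/dvdnP[c Kc]|nd].
  by exists c; rewrite xE Kc mulnC mulrnA chainD.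
have K0 : (0 < K)%N by rewrite lt0n; apply: contra nd => /eqP->.
have [u cpu Ku] := pfactor_coprime pp K0; set a := logn p K in Ku.
have aj : (a <= j)%N by rewrite leqNgt; apply: contra nd => ja; rewrite Ku dvdn_mull // dvdn_exp2l // ltnW.
have Yu : Y (e i *+ u).
  rewrite -(chainD i j) -mulrnA -(subnK aj) expnD -mulnA [X in (_ * X)%N]mulnC -Ku mulnC mulrnA.
  by rewrite subnK // -xE; apply: asubgMn.
have [t et] := chain_pprimary i.
have [|c ec] := mulrn_coprime (q := u) et; first by rewrite coprimeXr // coprime_sym.
by case: Yi; rewrite -ec mulrnA; apply: asubgMn.
Qed.

End Chain.

(** A divisible [p]-group is a direct sum of Pruefer groups, one per dimension of its socle; a
    finite socle thus expresses finite rank without a decomposition. *)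
Definition finite_prank p E :=
  [/\ asubg E, forall x, E x -> pprimary p x, pdivisible p E &
      listed (fun x => E x /\ x *+ p = 0)].

Lemma pprimaryD p x y : pprimary p x -> pprimary p y -> pprimary p (x + y).
Proof.
move=> [i xi] [j yj]; exists (i + j)%N.
by rewrite mulrnDl expnD mulrnA xi mul0rn mulnC mulrnA yj mul0rn addr0.
Qed.

Lemma pdivisible_add p B X : pdivisible p B -> pdivisible p X -> pdivisible p (addset B X).
Proof.
move=> dB dX _ [b [y [/dB[b' Bb' <-] /dX[y' Xy' <-] ->]]].
by exists (b' + y'); [exists b', y'|rewrite mulrnDl].
Qed.

Lemma finite_prank_zero p : prime p -> finite_prank p (fun x => x = 0).
Proof.
move=> pp; split; first exact: asubg_zero.
- by move=> x ->; exists 0%N; rewrite mul0rn.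
- by move=> x ->; exists 0; rewrite ?mul0rn.
- by exists [:: 0] => x [-> _]; rewrite mem_head.
Qed.

(** If [a + q] is killed by [p], then [q *+ p] lies in [E]. Unless [E] contains the whole chain, it
    meets it in a finite group; this leaves finitely many [q], and finitely many [a] for each. *)
Lemma finite_prank_add_chain p E e : prime p -> finite_prank p E ->
  (forall i, e i.+1 *+ p = e i) -> pprimary p (e 0%N) -> e 0%N *+ p != 0 ->
  finite_prank p (addset E (chain_span e)).
Proof.
move=> pp [sE tE dE fE] ch te e0; have sP := chain_span_subg pp ch te.
split; first exact: asubg_add.
- move=> _ [a [q [Ea Pq ->]]]; apply: pprimaryD; first exact: tE.
  exact: chain_span_pprimary ch te _ Pq.
- by apply: pdivisible_add => //; apply: chain_span_pdivisible.
have fP : listed (fun x => chain_span e x /\ x *+ p = 0).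
  have [l hl] := chain_mulrn_listed pp ch te 0; exists l => x [Px xp]; apply: hl.
  apply: (chain_span_cap pp ch te (Y := fun x => x *+ p = 0)) => //; last exact/eqP.
  by split=> [|y z yp zp]; rewrite ?mul0rn // mulrnBl yp zp subr0.
case: (pselect (exists i, ~ E (e i))) => [[i nEi]|Ee]; last first.
  apply: listed_sub fE => _ [[a [_ [Ea [i [k ->]] ->]]] ?]; split=> //.
  apply: asubgD => //; apply: asubgMn => //.
  by case: (pselect (E (e i))) => // nEi; case: Ee; exists i.
have fEP : listed (fun q => chain_span e q /\ E (q *+ p)).
  have [l hl] := chain_mulrn_listed pp ch te i.
  apply: listed_sub (@listed_bigU _ _ l (fun c q => chain_span e q /\ q *+ p = c) _) => [q [Pq Eqp]|c _].
    exists (q *+ p) => //; apply: hl; apply: (chain_span_cap pp ch te sE nEi Eqp).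
    exact: asubgMn.
  apply: listed_coset fP => x y [Px xp] [Py yp]; split; first exact: sP.2.
  by rewrite mulrnBl xp yp subrr.
have [l hl] := fEP.
apply: listed_sub (@listed_bigU _ _ l (fun q x => E (x - q) /\ x *+ p = 0) _) => [x [[a [q [Ea Pq xE]]] xp]|q _].
  exists q; last by rewrite xE addrK -xE.
  apply: hl; split=> //.
  have -> : q *+ p = - (a *+ p) by apply/eqP; rewrite -addr_eq0 -mulrnDl addrC -xE xp.
  by apply: asubgN => //; apply: asubgMn.
apply: listed_coset fE => x y [Ex xp] [Ey yp]; split; last by rewrite mulrnBl xp yp subr0.
by have -> : x - y = x - q - (y - q) by [rewrite opprB addrA subrK]; apply: sE.2.
Qed.

(* Any subgroup of a divisible p-group of finite rank has a complement up to
   a finite intersection: as long as [B + X] misses some [e], adjoin to [X]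
   a Pruefer group through [e]. *)
Lemma near_complement p E B : prime p -> finite_prank p E -> asubg B ->
  (forall x, B x -> E x) ->
  exists X, [/\ asubg X, listed (fun x => B x /\ X x) &
              forall x, E x -> addset B X x].
Proof.
move=> pp [sE tE dE [l fE]] sB BE.
suff main n X : (pcount (fun x => ~ X x) l < n)%N -> asubg X -> pdivisible p X ->
    (forall x, X x -> E x) -> listed (fun x => B x /\ X x) ->
    exists X, [/\ asubg X, listed (fun x => B x /\ X x) & forall x, E x -> addset B X x].
  apply: (main _ (fun x => x = 0) (ltnSn _)); first exact: asubg_zero.
  - by move=> x ->; exists 0; rewrite ?mul0rn.
  - by move=> x ->; case: sE.
  - by exists [:: 0] => x [_ ->]; rewrite mem_head.
elim: n X => // n IH X ltn sX dX XE fX.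
case: (pselect (forall x, E x -> addset B X x)) => [|nall]; first by exists X.
have [x0 [Ex0 nx0]] : exists x, E x /\ ~ addset B X x.
  by apply: contra_notP nall => /forallNP h x Ex; apply: contra_notP (h x) => ?.
have [h hE] : exists h : V -> V, forall x, E x -> E (h x) /\ h x *+ p = x.
  suff /choice[h hE] : forall x, exists y, E x -> E y /\ y *+ p = x by exists h.
  move=> x; case: (pselect (E x)) => [/dE[y]|]; first by exists y.
  by exists 0.
pose e i := iter i h x0.
have Ee i : E (e i) by elim: i => // i /hE[].
have ch i : e i.+1 *+ p = e i by have [] := hE _ (Ee i).
have te : pprimary p (e 0%N) by apply: tE.
have sP := chain_span_subg pp ch te.
have PE x : chain_span e x -> E x by case=> i [k ->]; apply: asubgMn.
apply: (IH (addset X (chain_span e))).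
- have XX' x : X x -> addset X (chain_span e) x by apply: addsetl.
  (* Enlarging [X] gains a socle element: otherwise [X] would already contain the chain, and [x0]
     with it. *)
  have [x [Xx xp nXx]] : exists x, [/\ addset X (chain_span e) x, x *+ p = 0 & ~ X x].
    apply: contrapT => /forallNP nx; apply: nx0; apply: addsetr => //.
    apply: (pdivisible_socle (p := p) (Y := addset X (chain_span e)) sX) => //.
    + exact: asubg_add.
    + by move=> _ [a [q [/XE Ea /PE Eq ->]]]; apply: tE; apply: asubgD.
    + by move=> x Xx xp; apply: contra_notP (nx x) => ?.
    + by apply: addsetr => //; apply: (mem_chain_span e 0).
  rewrite ltnS in ltn; apply: leq_trans ltn; apply: (@ltn_pcount _ _ _ _ x) => //.
  + by move=> y nX' /XX'.
  + apply: fE; split=> //; case: Xx => [a [q [/XE Ea /PE Eq ->]]].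
    exact: asubgD.
- exact: asubg_add.
- by apply: pdivisible_add => //; apply: chain_span_pdivisible.
- by move=> _ [a [q [/XE Ea /PE Eq ->]]]; apply: asubgD.
have [L hL] := chain_mulrn_listed pp ch te 0.
(* If [b = a + q], then [q = b - a] lies in [B + X], which misses [e 0 = x0]; so [q] is one of the
   finitely many multiples of [e 0]. *)
apply: listed_sub (@listed_bigU _ _ L (fun q b => B b /\ X (b - q)) _) => [b [Bb [a [q [Xa Pq bE]]]]|q _].
  exists q; last by rewrite bE addrK -bE.
  apply: hL; apply: (chain_span_cap pp ch te (Y := addset B X)) => //; first exact: asubg_add.
  by exists b, (- a); split=> //; [apply: asubgN|rewrite bE addrAC subrr add0r].
apply: listed_coset fX => x y [Bx Xx] [By Xy]; split; first exact: sB.2.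
by have -> : x - y = x - q - (y - q) by [rewrite opprB addrA subrK]; apply: sX.2.
Qed.

(** The factor of [m] prime to [p] acts injectively on a [p]-group; for the power of [p], each fibre
    of multiplication by [p] is a coset of the finite socle. *)
Lemma finite_prank_torsion p E m : prime p -> finite_prank p E -> (0 < m)%N ->
  listed (fun x => E x /\ x *+ m = 0).
Proof.
move=> pp [sE tE dE fE] m0.
have fj j : listed (fun x => E x /\ x *+ p ^ j = 0).
  elim: j => [|j [l IH]]; first by exists [:: 0] => x []; rewrite mulr1n => _ ->; rewrite mem_head.
  apply: listed_sub (@listed_bigU _ _ l (fun c x => E x /\ x *+ p = c) _) => [x [Ex]|c _].
    by rewrite expnS mulrnA => xp; exists (x *+ p) => //; apply: IH; split=> //; apply: asubgMn.
  apply: listed_coset fE => x y [Ex xp] [Ey yp]; split; first exact: sE.2.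
  by rewrite mulrnBl xp yp subrr.
apply: listed_sub (fj (logn p m)) => x [Ex xm]; split=> //.
have [u cpu mu] := pfactor_coprime pp m0; have [j xj] := tE _ Ex.
have [|c xc] := mulrn_coprime (q := u) xj; first by rewrite coprimeXr // coprime_sym.
by rewrite -xc -mulrnA mulnAC -mu mulrnA xm mul0rn.
Qed.

End AbelianGroups.

(** * Finite group actions on divisible abelian groups *)

Section Action.
Variables (V : zmodType) (A : groupType) (act : A -> V -> V) (s : seq A).
Local Open Scope ring_scope.
Hypotheses (actB : forall g x y, act g (x - y) = act g x - act g y)
  (act1 : forall x, act 1%g x = x)
  (actM : forall g h x, act (g * h)%g x = act h (act g x)).
(** In the application [A] is [G] and [s] lists [K]: as [V] is abelian, [v * k] acts on it as
    [k]. *)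
Hypotheses (us : uniq s) (s1 : 1%g \in s)
  (sM : forall g h, g \in s -> h \in s -> (g * h)%g \in s)
  (sact : forall g, exists2 k, k \in s & act g =1 act k).
Hypotheses (tV : torsion V) (dV : adivisible (fun _ : V => True)).
Implicit Types (B D E X Y : V -> Prop) (x y v : V) (p : nat).

Lemma act0 g : act g 0 = 0.
Proof. by rewrite -[X in act g X](subrr 0) actB subrr. Qed.

Lemma actN g x : act g (- x) = - act g x.
Proof. by rewrite -sub0r actB act0 sub0r. Qed.

Lemma actD g x y : act g (x + y) = act g x + act g y.
Proof. by rewrite -{1}[y]opprK actB actN opprK. Qed.

Lemma actMn g x n : act g (x *+ n) = act g x *+ n.
Proof. by elim: n => [|n IH]; rewrite ?mulr0n ?act0 // !mulrS actD IH. Qed.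

Lemma act_sum g (I : Type) (r : seq I) (F : I -> V) :
  act g (\sum_(i <- r) F i) = \sum_(i <- r) act g (F i).
Proof. by elim/big_rec2: _ => [|i y1 y2 _ <-]; [exact: act0 | rewrite actD]. Qed.

Lemma sum_reindex (h : A -> A) (F : A -> V) : injective h ->
  (forall k, k \in s -> h k \in s) -> \sum_(k <- s) F k = \sum_(k <- s) F (h k).
Proof.
move=> ih hs; rewrite -(big_map h predT F); apply: perm_big; rewrite perm_sym.
have uh : uniq (map h s) by rewrite map_inj_uniq.
have hss : {subset map h s <= s} by move=> _ /mapP[k ks ->]; apply: hs.
by apply: uniq_perm => //; have [] := uniq_min_size uh hss; rewrite ?size_map.
Qed.

Definition invariant B := forall g x, B x -> B (act g x).

Definition aquasifinite D :=
  [/\ asubg D, invariant D, adivisible D, ~ listed D &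
     forall B, asubg B -> invariant B -> (forall x, B x -> D x) ->
       (exists x, D x /\ ~ B x) -> listed B].

(* Maschke's averaging trick, applied to the projection on [B] along a near
   complement, multiplied by the exponent of the intersection. *)
Lemma averaging p E B : prime p -> finite_prank p E -> invariant E ->
  asubg B -> invariant B -> (forall x, B x -> E x) ->
  exists m (f : V -> V), [/\ (0 < m)%N,
    forall x y, E x -> E y -> f (x - y) = f x - f y,
    forall g x, E x -> f (act g x) = act g (f x),
    forall x, E x -> B (f x) & forall x, B x -> f x = x *+ m].
Proof.
move=> pp rE iE sB iB BE; have [sE _ _ _] := rE.
have [X [sX fX EBX]] := near_complement pp rE sB BE.
have [n n0 hn] := listed_exponent tV fX.
have /choice[b hb] : forall x, exists b, E x -> B b /\ X (x - b).
  move=> x; case: (pselect (E x)) => [/EBX[b [y [Bb Xy ->]]]|]; last by exists 0.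
  by exists b => _; rewrite addrAC subrr add0r.
pose pr x := b x *+ n.
have prE x c : E x -> B c -> X (x - c) -> pr x = c *+ n.
  move=> /hb[Bb Xb] Bc Xc; apply/eqP; rewrite -subr_eq0 -mulrnBl; apply/eqP.
  apply: hn; split; first exact: sB.2.
  have -> : b x - c = (x - c) - (x - b x) by rewrite opprB [RHS]addrC -addrA [- x + _]addrA addNr add0r.
  exact: sX.2.
have prB x y : E x -> E y -> pr (x - y) = pr x - pr y.
  move=> Ex Ey; have [Bx Xx] := hb _ Ex; have [By Xy] := hb _ Ey.
  rewrite (prE _ (b x - b y)); first by rewrite mulrnBl.
  - exact: sE.2.
  - exact: sB.2.
  - have -> : x - y - (b x - b y) = (x - b x) - (y - b y) by rewrite !opprB addrACA [RHS]addrACA [- b x - y]addrC.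
    exact: sX.2.
exists (n * size s)%N, (fun x => \sum_(k <- s) act k (pr (act k^-1%g x))); split.
- by rewrite muln_gt0 n0; case: s s1.
- move=> x y Ex Ey; rewrite -sumrB; apply: eq_bigr => k _.
  by rewrite actB prB ?actB //; apply: iE.
- move=> g x Ex; have [h hs gh] := sact g.
  rewrite !gh act_sum (@sum_reindex (fun k => k * h)%g); last first.
  + by move=> k ks; apply: sM.
  + exact: mulIg.
  apply: eq_bigr => k _.
  by rewrite actM -(actM h) invgM mulVKg.
- move=> x Ex; apply: asubg_sum => // k _; apply: (iB k); apply: asubgMn => //.
  by have [] := hb _ (iE k^-1%g _ Ex).
- move=> x Bx; rewrite (eq_bigr (fun=> x *+ n)) => [|k _].
    by rewrite big_const_seq count_predT iter_addr_0 -mulrnA.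
  have Bk := iB k^-1%g _ Bx.
  rewrite (prE _ (act k^-1%g x)) ?subrr //; [|exact: BE|by case: sX].
  by rewrite actMn -actM mulVg act1.
Qed.

Definition aquasifinite_span x := forall H, asubg H ->
  (forall D, aquasifinite D -> forall y, D y -> H y) -> H x.

Lemma aquasifinite_span_subg : asubg aquasifinite_span.
Proof.
split=> [H [] //|x y Hx Hy H sH HD]; apply: sH.2; [exact: Hx|exact: Hy].
Qed.

Section Image.
Variables (D : V -> Prop) (f : V -> V).
Hypotheses (sD : asubg D) (fB : forall x y, D x -> D y -> f (x - y) = f x - f y).

(** Additivity is asked on [D] only, because the map produced by [averaging] comes from choices and
    is additive just on [E]. *)
Definition image y := exists2 x, D x & y = f x.

Lemma image_subg : asubg image.
Proof.
split=> [|_ _ [x Dx ->] [y Dy ->]]; last by exists (x - y); [apply: sD.2|rewrite fB].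
have D0 := sD.1; by exists 0 => //; rewrite -[X in f X](subrr 0) fB // subrr.
Qed.

Lemma image_invariant : invariant D ->
  (forall g x, D x -> f (act g x) = act g (f x)) -> invariant image.
Proof. by move=> iD fg g _ [x Dx ->]; exists (act g x); [apply: iD|rewrite fg]. Qed.

Lemma additive_on_mulrn x n : D x -> f (x *+ n) = f x *+ n.
Proof.
move=> Dx.
have f0 : f 0 = 0 by rewrite -[X in f X](subrr 0) fB ?subrr //; exact: sD.1.
have fN z : D z -> f (- z) = - f z by move=> Dz; rewrite -sub0r fB ?f0 ?sub0r //; exact: sD.1.
elim: n => [|n IH]; first by rewrite !mulr0n f0.
rewrite !mulrS -IH -{1}[x *+ n]opprK fB ?fN ?opprK //; first exact: asubgMn.
by apply: asubgN => //; apply: asubgMn.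
Qed.

Lemma image_adivisible : adivisible D -> adivisible image.
Proof.
move=> dD _ n [x Dx ->] n0; have [y Dy <-] := dD x n Dx n0.
by exists (f y); [exists y|rewrite additive_on_mulrn].
Qed.

End Image.

(** Induction on the number of socle elements in [D]. Given an infinite proper invariant [B], the
    map [f] of [averaging] and [g = m - f] have proper divisible invariant images, and
    [m y = g y + f y] runs through all of [D]. *)
Lemma finite_prank_span p E D : prime p -> finite_prank p E -> invariant E ->
  asubg D -> invariant D -> adivisible D -> (forall x, D x -> E x) ->
  forall x, D x -> aquasifinite_span x.
Proof.
move=> pp rE iE; have [sE tE dE [l hl]] := rE.
have [n] := ubnP (pcount D l).
elim: n D => // n IH D; rewrite ltnS => leDn sD iD dD DE x Dx.
case: (pselect (listed D)) => [fD|infD].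
  have [k k0 Dk] := listed_exponent tV fD.
  by rewrite (adivisible_exponent dD k0 Dk Dx); apply: (aquasifinite_span_subg).1.
case: (pselect (aquasifinite D)) => [qD H sH /(_ D qD)|nqD]; first exact.
have [B [sB iB BD [z [Dz nBz]] infB]] : exists B, [/\ asubg B, invariant B,
    forall x, B x -> D x, exists x, D x /\ ~ B x & ~ listed B].
  apply: contra_notP nqD => /forallNP nB; split=> // B sB iB BD pB.
  by apply: contra_notP (nB B).
have BE y : B y -> E y by move/BD/DE.
have [m [f [m0 fB fg fE fm]]] := averaging pp rE iE sB iB BE.
pose g x := x *+ m - f x.
have fBD u v : D u -> D v -> f (u - v) = f u - f v by move=> /DE Eu /DE Ev; apply: fB.
have gBD u v : D u -> D v -> g (u - v) = g u - g v.
  by move=> Du Dv; rewrite /g fBD // mulrnBl !opprB addrACA [RHS]addrACA [- f _ - _]addrC.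
have gg h y : D y -> g (act h y) = act h (g y).
  by move=> /DE Ey; rewrite /g fg // actB actMn.
have gD y : D y -> D (g y).
  by move=> Dy; apply: sD.2; [apply: asubgMn|apply/BD/fE/DE].
have step (f' : V -> V) : (forall x y, D x -> D y -> f' (x - y) = f' x - f' y) ->
    (forall h y, D y -> f' (act h y) = act h (f' y)) ->
    (forall y, D y -> D (f' y)) -> (exists x, D x /\ ~ image D f' x) ->
    forall y, D y -> aquasifinite_span (f' y).
  move=> f'B f'g f'D [w [Dw nw]] y Dy.
  have f'im v : image D f' v -> D v by case=> u /f'D Du ->.
  have sI := image_subg sD f'B; have dI := image_adivisible sD f'B dD.
  apply: (IH (image D f')) => //.
  - have [u [Du up nIu]] : exists u, [/\ D u, u *+ p = 0 & ~ image D f' u].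
      apply: contrapT => /forallNP nu; apply: nw.
      apply: (pdivisible_socle (p := p) (Y := D) sI f'im sD) => //.
      + by move=> v /DE/tE.
      + by move=> v Iv; apply: dI => //; apply: prime_gt0.
      + by move=> v Dv vp; apply: contra_notP (nu v).
    apply: leq_trans leDn; apply: (@ltn_pcount _ _ _ _ u) => //.
    by apply: hl; split=> //; apply: DE.
  - exact: image_invariant.
  - by move=> v /f'im/DE.
  - by exists y.
have [y Dy <-] := dD x m Dx m0.
rewrite -[y *+ m](subrK (f y)); apply: (asubgD aquasifinite_span_subg).
  apply: (step g) => //.
  (* [f] vanishes on the image of [g], being multiplication by [m] on each [f u]. If [g] were onto,
     every [b] in [B] would satisfy [m b = f b = 0], making [B] finite. *)
  apply: contrapT => /forallNP nI; apply: infB.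
  apply: listed_sub (finite_prank_torsion pp rE m0) => b Bb; split; first exact: BE.
  have [u Du bE] : image D g b by apply: contrapT => nIb; apply: (nI b); split=> //; apply: BD.
  have Bfu := fE _ (DE _ Du); have Dum : D (u *+ m) by apply: asubgMn.
  rewrite -(fm b Bb) bE /g fBD //; last exact: BD.
  by rewrite (additive_on_mulrn sD fBD) // (fm (f u)) // subrr.
apply: (step f) => //.
- by move=> h u Du; apply: fg; apply: DE.
- by move=> u /DE/fE/BD.
- exists z; split=> // -[u /DE/fE Bfu zE]; by apply: nBz; rewrite zE.
Qed.

Lemma pprimary_span p v : prime p -> pprimary p v -> aquasifinite_span v.
Proof.
move=> pp [j vj]; case: (eqVneq v 0) => [->|v0]; first by case: aquasifinite_span_subg.
have /choice[h hp] : forall x, exists y, y *+ p = x.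
  by move=> x; have [y _ yp] := @dV x p I (prime_gt0 pp); exists y.
(* The chain starts at a [p]-th root of [v], so that [e 0 *+ p = v] is nonzero, as
   [finite_prank_add_chain] demands. *)
pose e i := iter i h (h v).
have ch i : e i.+1 *+ p = e i by apply: hp.
have te k : pprimary p (act k (e 0%N)).
  by exists j.+1; rewrite -actMn expnS mulrnA hp vj act0.
have chk k i : act k (e i.+1) *+ p = act k (e i) by rewrite -actMn ch.
pose P k := chain_span (fun i => act k (e i)).
have sP k : asubg (P k) by exact: chain_span_subg pp (chk k) (te k).
pose E l := foldr (fun k B => addset B (P k)) (fun x => x = 0) l.
have rE l : finite_prank p (E l).
  elim: l => [|k l IH]; first exact: finite_prank_zero.
  apply: (finite_prank_add_chain pp IH (chk k) (te k)); rewrite -actMn hp.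
  by apply: contra v0 => /eqP/(congr1 (act k^-1%g)); rewrite -actM mulgV act1 act0 => ->.
have sE l : asubg (E l) by have [] := rE l.
have EP l k x : k \in l -> P k x -> E l x.
  elim: l => //= k' l IH; rewrite inE => /orP[/eqP<- Pkx|kl Pkx]; first exact: addsetr.
  by apply: addsetl => //; apply: IH.
have Emin l H : asubg H -> (forall k x, k \in l -> P k x -> H x) -> forall x, E l x -> H x.
  move=> sH; elim: l => /= [_ x ->|k l IH HP _ [b [y [Eb Py ->]]]]; first by case: sH.
  apply: asubgD => //; last by apply: HP Py; rewrite mem_head.
  by apply: IH Eb => k' x k'l; apply: HP; rewrite inE k'l orbT.
have iE : invariant (E s).
  move=> g x Ex; have [k ks gk] := sact g; rewrite gk.
  apply: (Emin s (fun x => E s (act k x))) Ex; first split.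
  - by rewrite act0; case: (sE s).
  - by move=> y z Ey Ez; rewrite actB; apply: (sE s).2.
  - move=> k' _ k's [i [n ->]]; rewrite actMn -actM; apply: asubgMn => //.
    by apply: (EP _ (k' * k)%g); [exact: sM|exact: mem_chain_span].
have [_ tE dE _] := rE s.
apply: (finite_prank_span pp (rE s) iE (sE s) iE) => //.
  exact: pprimary_adivisible pp (sE s) tE dE.
apply: (EP s _ _ s1); exists 0%N, p; by rewrite act1 hp.
Qed.

Theorem aquasifinite_span_full v : aquasifinite_span v.
Proof.
have [n] := tV v; elim/ltn_ind: n v => n IH v n0 vn.
have [n1|] := ltnP 1 n; last first.
  case: n n0 vn {IH} => [//|[|//]] _; rewrite mulr1n => ->.
  by case: aquasifinite_span_subg.
have pp := pdiv_prime n1; set p := pdiv n in pp.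
have [u cpu nu] := pfactor_coprime pp n0; set a := logn p n in nu.
have a0 : (0 < a)%N by rewrite logn_gt0 mem_primes pp n0 pdiv_dvd.
have u0 : (0 < u)%N by case: u nu {cpu} => // n00; rewrite n00 in n0.
have lt : (u < n)%N by rewrite nu ltn_Pmulr // -(expn0 p) ltn_exp2l // prime_gt1.
have cpau : coprime (p ^ a) u by rewrite coprimeXl.
case: (@egcdnP (p ^ a) u) => [|c d cd _]; first by rewrite expn_gt0 prime_gt0.
(* Bezout splits [v] into a part killed by [u < n], left to the induction, and a part killed by
   [p ^ a]. *)
have vE : v *+ (c * p ^ a) - v *+ (d * u) = v.
  by rewrite cd (eqP cpau) mulrnDr mulr1n addrAC subrr add0r.
rewrite -vE; apply: (aquasifinite_span_subg).2.
  apply: (IH u) => //; rewrite -mulrnA -mulnA [(p ^ a * u)%N]mulnC -nu mulnC mulrnA vn.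
  by rewrite mul0rn.
apply: (@pprimary_span p) => //; exists a.
by rewrite -mulrnA -mulnA -nu mulnC mulrnA vn mul0rn.
Qed.

(* If the subgroup generated by the [k d - d] were proper, it would be finite;
   divisibility would then force [s] to fix [D], on which the norm is
   multiplication by [size s]. *)
Lemma aquasifinite_commutators D H : (forall v, \sum_(k <- s) act k v = 0) ->
  aquasifinite D -> asubg H ->
  (forall k d, k \in s -> D d -> H (act k d - d)) -> forall d, D d -> H d.
Proof.
move=> nm [sD iD dD infD qD] sH HD d Dd.
(* [H] need not be invariant or lie in [D]; quasifiniteness is applied to the subgroup generated by
   the [act k y - y] instead. *)
pose H0 x := forall H', asubg H' ->
  (forall k d, k \in s -> D d -> H' (act k d - d)) -> H' x.
have sH0 : asubg H0 by split=> [H' []//|x y Hx Hy H' sH' H'D]; apply: sH'.2; [apply: Hx|apply: Hy].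
have H0g k y : k \in s -> D y -> H0 (act k y - y) by move=> ks Dy H' sH'; apply.
have H0D x : H0 x -> D x by apply=> // k y ks Dy; apply: sD.2 => //; apply: iD.
have iH0 : invariant H0.
  move=> g x; have [h hs gh] := sact g; rewrite gh => H0x.
  apply: (H0x (fun x => H0 (act h x))); first split.
  - by rewrite act0; case: sH0.
  - by move=> y z H0y H0z; rewrite actB; apply: sH0.2.
  - move=> k y ks Dy; rewrite actB -actM.
    have -> : act (k * h)%g y - act h y = (act (k * h)%g y - y) - (act h y - y).
      by rewrite opprB addrA subrK.
    by apply: sH0.2; apply: H0g => //; apply: sM.
case: (pselect (H0 d)) => [|nH0d]; first exact.
have [|n n0 hn] := listed_exponent tV (qD H0 sH0 iH0 H0D _); first by exists d.
case: infD; have s0 : (0 < size s)%N by case: s s1.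
exists [:: 0] => x Dx; rewrite inE; apply/eqP.
apply: (adivisible_exponent dD s0 _ Dx) => y Dy.
rewrite -[RHS](nm y) (eq_big_seq (fun=> y)) ?big_const_seq ?count_predT ?iter_addr_0 //.
(* With [y = z *+ n], the difference [act k y - y] is [n] times an element of [H0], hence zero. *)
move=> k ks; have [z Dz <-] := dD y n Dy n0.
by apply/eqP; rewrite -subr_eq0 actMn -mulrnBl hn //; apply: H0g.
Qed.

End Action.

(** * Abstract groups and quotients *)

HB.instance Definition _ (G : AbsGroup) := gen_eqMixin (gcar G).
HB.instance Definition _ (G : AbsGroup) := gen_choiceMixin (gcar G).

Section AbsGroupIsGroup.
Variable G : AbsGroup.

Fact abs_mulgV : right_inverse (gone G) (@ginv G) (@gmul G).
Proof.
move=> x; rewrite -[LHS]gmul1 -{1}(gmulV G (ginv G x)) -gmulA.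
by rewrite [X in gmul G _ X]gmulA gmulV gmul1 gmulV.
Qed.

Fact abs_mulg1 : right_id (gone G) (@gmul G).
Proof. by move=> x; rewrite -(gmulV G x) gmulA abs_mulgV gmul1. Qed.

End AbsGroupIsGroup.

HB.instance Definition _ (G : AbsGroup) := isGroup.Build (gcar G)
  (@gmulA G) (@gmul1 G) (@abs_mulg1 G) (@gmulV G) (@abs_mulgV G).

Local Open Scope group_scope.

Lemma gpowE (G : AbsGroup) (x : G) n : gpow x n = x ^+ n.
Proof. by elim: n => //= n ->; rewrite expgS. Qed.

Lemma hypercentre_comm_ind (G : AbsGroup) (P : G -> Prop) :
  hypercentral G -> P 1 ->
  (forall x, (forall g, P [~ x, g]) -> P x) -> forall x, P x.
Proof. by move=> hG P1 PS x; elim: (hG x) => // {}x _; apply: PS. Qed.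

Section Subgroups.
Variable G : AbsGroup.
Implicit Types (H N K : gsub G) (x y g : G).

Lemma subg1 H : subgroup H -> H 1.
Proof. by case. Qed.

Lemma subgM H x y : subgroup H -> H x -> H y -> H (x * y).
Proof. by case=> _ [+ _] => /[apply]/[apply]. Qed.

Lemma subgV H x : subgroup H -> H x -> H x^-1.
Proof. by case=> _ [_ +] => /[apply]. Qed.

Lemma subgX H x n : subgroup H -> H x -> H (x ^+ n).
Proof.
move=> sH Hx; elim: n => [|n IH]; first exact: subg1.
by rewrite expgS; apply: subgM.
Qed.

Lemma subgJ H x y : subgroup H -> H x -> H y -> H (x ^ y).
Proof. by move=> sH Hx Hy; apply/(subgM sH)/(subgM sH) => //; apply: subgV. Qed.

Lemma normalJ N x g : normal N -> N x -> N (x ^ g).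
Proof. by case=> _; apply. Qed.

Lemma normal_sub N : normal N -> subgroup N. Proof. by case. Qed.

Lemma normalR N x g : normal N -> N x -> N [~ x, g].
Proof.
move=> nN Nx; have sN := normal_sub nN.
by apply: (subgM sN); [apply: subgV|apply: normalJ].
Qed.

Lemma contranormalP K N : contranormal K -> normal N -> gsubset K N -> forall x, N x.
Proof. by move=> [_ cK] nN KN x; have [_ /(_ I)] := cK x; apply. Qed.

Lemma whole_normal : normal (whole G). Proof. by []. Qed.

Lemma trivial_normal : normal (fun x : G => x = 1).
Proof.
split; last by move=> x g ->; apply: conj1g.
split=> //; split=> [x y -> ->|x ->]; [exact: mulg1|exact: invg1].
Qed.

Lemma prod_subgroup N K : normal N -> subgroup K ->
  subgroup (fun x => exists n k, [/\ N n, K k & x = n * k]).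
Proof.
move=> nN sK; have sN := normal_sub nN.
split; first by exists 1, 1; rewrite mulg1; split=> //; apply: subg1.
split=> [_ _ [a [b [Na Kb ->]]] [c [d [Nc Kd ->]]]|_ [a [b [Na Kb ->]]]].
  exists (a * c ^ b^-1), (b * d); split; [|exact: subgM|].
    by apply: subgM => //; apply: normalJ.
  by change (a * b * (c * d) = a * c ^ b^-1 * (b * d)); rewrite conjgE invgK -!mulgA mulKg.
exists ((a^-1) ^ b), b^-1; split; [|exact: subgV|].
  by apply: normalJ => //; apply: subgV.
by change ((a * b)^-1 = a^-1 ^ b * b^-1); rewrite conjgE invgM !mulgA mulgK.
Qed.

End Subgroups.

Section Quotient.
Variables (G : AbsGroup) (N : gsub G).
Hypothesis nN : normal N.

Let coset (x : G) : gsub G := fun y => N (x^-1 * y).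
Let cosets := {S : gsub G | exists x : G, S = coset x}.
Let proj (x : G) : cosets := exist _ (coset x) (ex_intro _ x erefl).

Let proj_surj q : exists x, proj x = q.
Proof. by case: q => S [x SE]; exists x; apply: eq_exist. Qed.

Let proj_eq x y : proj x = proj y <-> N (x^-1 * y).
Proof.
have sN := normal_sub nN; split=> [[/(congr1 (@^~ y))]|Nxy].
  by rewrite /coset mulVg => ->; apply: subg1.
apply: eq_exist; apply/funext => z; apply/propext; rewrite /coset.
have Nyx : N (y^-1 * x) by rewrite -[x]invgK -invgM; apply: subgV.
split=> Nz; first by rewrite -[y^-1](mulgK x) -mulgA; apply: subgM.
by rewrite -[x^-1](mulgK y) -mulgA; apply: subgM.
Qed.

Let rep q := projT1 (cid (proj_surj q)).
Let repK q : proj (rep q) = q.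
Proof. by rewrite /rep; case: cid. Qed.

Let qmul p q := proj (rep p * rep q).
Let qinv q := proj (rep q)^-1.

Let projM x y : qmul (proj x) (proj y) = proj (x * y).
Proof.
apply/proj_eq; have sN := normal_sub nN.
have Nx : N ((rep (proj x))^-1 * x) by apply/proj_eq; rewrite repK.
have Ny : N ((rep (proj y))^-1 * y) by apply/proj_eq; rewrite repK.
set a := rep _ in Nx *; set b := rep _ in Ny *.
have -> : (a * b)^-1 * (x * y) = (a^-1 * x) ^ b * (b^-1 * y).
  by rewrite conjgE invgM -!mulgA mulVKg.
by apply: subgM => //; apply: normalJ.
Qed.

Let projV x : qinv (proj x) = proj x^-1.
Proof.
apply/proj_eq; have sN := normal_sub nN.
have Nx : N ((rep (proj x))^-1 * x) by apply/proj_eq; rewrite repK.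
set a := rep _ in Nx *.
have -> : a^-1^-1 * x^-1 = ((a^-1 * x)^-1) ^ a^-1.
  by rewrite conjgE !invgM !invgK mulgK.
by apply: normalJ => //; apply: subgV.
Qed.

Let qmulA x y z : qmul x (qmul y z) = qmul (qmul x y) z.
Proof. by rewrite -[x]repK -[y]repK -[z]repK !projM mulgA. Qed.

Let qmul1 x : qmul (proj 1) x = x.
Proof. by rewrite -[x]repK projM mul1g. Qed.

Let qmulV x : qmul (qinv x) x = proj 1.
Proof. by rewrite -[x]repK projV projM mulVg. Qed.

(** Cosets are predicates, so extensionality makes them equal when they should be; from here on a
    quotient is just an epimorphism with kernel [N]. *)
Lemma quotient_exists : exists (Q : AbsGroup) (f : G -> Q),
  [/\ {morph f : x y / x * y}, forall q, exists x, f x = q &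
      forall x, f x = 1 <-> N x].
Proof.
exists (@Build_AbsGroup cosets qmul (proj 1) qinv qmulA qmul1 qmulV), proj; split.
- by move=> x y; rewrite -projM.
- exact: proj_surj.
- move=> x; have sN := normal_sub nN; split=> [/esym/proj_eq|Nx].
    by rewrite invg1 mul1g.
  by apply/esym/proj_eq; rewrite invg1 mul1g.
Qed.

End Quotient.

Section Epimorphism.
Variables (G Q : AbsGroup) (f : G -> Q).
Hypotheses (fM : {morph f : x y / x * y}) (fS : forall q, exists x, f x = q).

Lemma epi1 : f 1 = 1.
Proof. by apply: (mulgI (f 1)); rewrite -fM !mulg1. Qed.

Lemma epiV x : f x^-1 = (f x)^-1.
Proof. by apply: (mulgI (f x)); rewrite -fM !mulgV epi1. Qed.

Lemma epiX x n : f (x ^+ n) = f x ^+ n.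
Proof. by elim: n => [|n IH]; rewrite ?epi1 // !expgS fM IH. Qed.

Lemma epiJ x y : f (x ^ y) = f x ^ f y.
Proof. by rewrite !conjgE !fM epiV. Qed.

Lemma epiR x y : f [~ x, y] = [~ f x, f y].
Proof. by rewrite !commgEl fM epiV epiJ. Qed.

Lemma preim_normal N : normal N -> normal (fun x => N (f x)).
Proof.
move=> nN; have sN := normal_sub nN; split; last first.
  by move=> x g Nx; change (N (f (x ^ g))); rewrite epiJ; apply: normalJ.
split; first by rewrite epi1; apply: subg1.
split=> [x y Nx Ny|x Nx]; first by rewrite fM; apply: subgM.
by rewrite epiV; apply: subgV.
Qed.

Definition im (V : gsub G) : gsub Q := fun q => exists2 x, V x & f x = q.

Lemma im_normal V : normal V -> normal (im V).
Proof.
move=> nV; have sV := normal_sub nV; split; last first.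
  move=> _ q [x Vx <-]; have [g <-] := fS q.
  by exists (x ^ g); [apply: normalJ|rewrite epiJ].
split; first by exists 1; [apply: subg1|apply: epi1].
split=> [_ _ [x Vx <-] [y Vy <-]|_ [x Vx <-]].
  by exists (x * y); [apply: subgM|rewrite fM].
by exists x^-1; [apply: subgV|rewrite epiV].
Qed.

Lemma epi_hypercentral : hypercentral G -> hypercentral Q.
Proof.
move=> hG q; have [x <-] := fS q; elim: (hG x) => [|{}x _ IH].
  by rewrite epi1; apply: hyc_one.
apply: hyc_step => r; have [g <-] := fS r.
by have -> : comm (f x) (f g) = f [~ x, g] by [rewrite epiR]; apply: IH.
Qed.

End Epimorphism.

(** * Torsion *)

Section Torsion.
Variable G : AbsGroup.
Implicit Types (N K T : gsub G) (x y g : G).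

(* For [x] in the second centre, [g |-> [~ x, g]] is a morphism to the centre,
   which has no m-torsion; so it kills [K], hence its normal closure [G]. *)
Lemma central_torsion_free_trivial K m : hypercentral G -> contranormal K ->
  (forall k, K k -> k ^+ m = 1) ->
  (forall x, (forall g, [~ x, g] = 1) -> x ^+ m = 1 -> x = 1) ->
  forall x, x = 1.
Proof.
move=> hG cK Km tf.
have cent : forall x g, [~ x, g] = 1.
  apply: (hypercentre_comm_ind hG); first exact: comm1g.
  move=> x IH.
  have cR g h : commute [~ x, g] h by apply/commgP/eqP.
  have xJ g : x ^ g = x * [~ x, g] by rewrite commgEl mulVKg.
  suff C g : commute x g by move=> g; apply/eqP/commgP.
  apply: (contranormalP (N := fun g => commute x g) cK).
    split; last first.
      move=> y h xy; change (commute x (y ^ h)).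
      have : commute (x ^ h^-1) y.
        by rewrite xJ; apply: commute_sym; apply: commuteM; apply: commute_sym; [|apply: cR].
      move=> e; have : (x * y ^ h) ^ h^-1 = (y ^ h * x) ^ h^-1 by rewrite (conjMg x) (conjMg (y ^ h)) conjgK.
      exact: conjg_inj.
    split; first exact: commute1.
    by split=> [y z|y]; [apply: commuteM|apply: commuteV].
  move=> k Kk; apply/commgP/eqP; apply: tf; first by move=> h; apply/eqP/commgP.
  (* Since [[~ x, k]] is central, [k ^+ m = 1] yields [[~ x, k] ^+ m = 1]. *)
  have xn n : x ^ (k ^+ n) = x * [~ x, k] ^+ n.
    elim: n => [|n IHn]; first by rewrite conjg1 mulg1.
    rewrite expgSr conjgM IHn conjMg conjXg xJ.
    have -> : [~ x, k] ^ k = [~ x, k] by apply/conjg_fixP/commgP.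
    by rewrite -mulgA -expgS.
  by apply: (mulgI x); rewrite -xn Km // conjg1 mulg1.
(* The group is now abelian, so [tf] applies to the elements of [K] and makes [K] trivial. *)
apply: (contranormalP cK (trivial_normal G)) => k Kk.
by apply: tf; [exact: cent|exact: Km].
Qed.

(** Only primes dividing [m] may occur in the order of [x]; plain torsion would not bound the primes
    of [G] by those of [K]. *)
Definition power_torsion m x := exists j, x ^+ (m ^ j)%N = 1.

Lemma power_torsionX m x : power_torsion m (x ^+ m) -> power_torsion m x.
Proof. by case=> j xj; exists j.+1; rewrite expnS expgnA. Qed.

Definition radical m x :=
  exists N, [/\ normal N, forall y, N y -> power_torsion m y & N x].

(** Modulo [N], a power of [a * b] is the same power of [b]; so the product of two such normal
    subgroups is again one. *)
Lemma radical_normal m : normal (radical m).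
Proof.
split; last first.
  by move=> x g [N [nN Nm Nx]]; exists N; split=> //; apply: normalJ.
split; first exists (fun x => x = 1).
  by split=> // [|y ->]; [exact: trivial_normal|exists 0%N; rewrite expg1n].
split=> [x y [N [nN Nm Nx]] [M [nM Mm My]]|x [N [nN Nm Nx]]]; last first.
  by exists N; split=> //; apply: subgV => //; apply: normal_sub.
have sN := normal_sub nN; have sM := normal_sub nM.
exists (fun z => exists a b, [/\ N a, M b & z = a * b]); split.
- split; first exact: prod_subgroup.
  move=> _ g [a [b [Na Mb ->]]]; exists (a ^ g), (b ^ g); rewrite -conjMg.
  by split=> //; apply: normalJ.
- move=> _ [a [b [Na Mb ->]]].
  have ab n : exists2 c, N c & (a * b) ^+ n = c * b ^+ n.
    elim: n => [|n [c Nc IH]]; first by exists 1; [apply: subg1|rewrite mulg1].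
    exists (a * c ^ b^-1); first by apply: subgM => //; apply: normalJ.
    by rewrite expgS IH conjgE invgK expgS -!mulgA mulKg.
  have [j bj] := Mm _ Mb; have [c /Nm[i ci] abj] := ab (m ^ j)%N.
  by exists (j + i)%N; rewrite expnD expgnA abj bj mulg1.
- by exists x, y.
Qed.

Lemma radical_torsion m x : radical m x -> power_torsion m x.
Proof. by case=> N [_ Nm /Nm]. Qed.

End Torsion.

Theorem contranormal_torsion (G : AbsGroup) (K : gsub G) m :
  0 < m -> hypercentral G -> contranormal K ->
  (forall k, K k -> k ^+ m = 1) -> forall x : G, power_torsion m x.
Proof.
move=> m0 hG cK Km x; apply: radical_torsion.
have nT := radical_normal G m; have [Q [f [fM fS fT]]] := quotient_exists nT.
apply/fT; have sK := cK.1.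
have cfK : contranormal (im f K).
  split; last first.
    move=> q; split=> // _ N nN KN; have [y <-] := fS q.
    apply: (contranormalP cK (preim_normal fM nN)) => k Kk.
    by apply: KN; exists k.
  split; first by exists 1; [apply: subg1|apply: epi1].
  split=> [_ _ [a Ka <-] [b Kb <-]|_ [a Ka <-]].
    by exists (a * b); [apply: subgM|rewrite fM].
  by exists a^-1; [apply: subgV|rewrite epiV].
apply: (central_torsion_free_trivial (K := im f K) (m := m)) => //.
- exact: epi_hypercentral fM fS hG.
- by move=> _ [k Kk <-]; rewrite -epiX // Km // epi1.
move=> q; have [y <-] := fS q => cq yq; apply/fT.
(* A central [f y] with [f y ^+ m = 1] spans a normal subgroup; its preimage is still torsion for
   powers of [m], hence lies in the radical. *)
exists (fun z => exists n, f z = f y ^+ n); split; last by exists 1%N.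
- split; last first.
    move=> z g [n zn]; exists n; change (f (z ^ g) = f y ^+ n); rewrite epiJ // zn.
    apply/conjg_fixP/commgP/commute_sym/commuteX/commute_sym/commgP/eqP.
    exact: cq.
  split; first by exists 0%N; rewrite epi1.
  split=> [a b [i ai] [j bj]|a [i ai]].
    by exists (i + j)%N; rewrite fM ai bj expgnDr.
  exists (i * m.-1)%N; rewrite epiV // ai; apply/mulg1_eq.
  by rewrite -expgnDr -mulnS prednK // mulnC expgnA yq expg1n.
- move=> z [n zn]; apply: power_torsionX; apply: radical_torsion; apply/fT.
  by rewrite epiX // zn expgnAC yq expg1n.
Qed.

(** * The least normal subgroup of finite index *)

Section FiniteIndex.
Variable G : AbsGroup.
Implicit Types (H N K V : gsub G) (x y g : G).

(** Each fibre of [f] lies in one coset of [N], so the index is at most the size of [F]; [f] may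
    split cosets further. *)
Definition finidx N :=
  exists (F : finType) (f : G -> F), forall x y, f x = f y -> N (x * y^-1).

(** For infinite [H], the mere inclusion of a conjugate in [H] would not be stable under inverting
    [x]; the equivalence is. *)
Lemma normalizer_subgroup H : subgroup (fun x => forall h, H h <-> H (h ^ x)).
Proof.
split; first by move=> h; rewrite conjg1.
split=> [x y Hx Hy h|x Hx h]; first by rewrite Hx Hy -conjgM.
by rewrite (Hx (h ^ x^-1)) conjgKV.
Qed.

Lemma sub_normalizer H x : subgroup H -> H x -> forall h, H h <-> H (h ^ x).
Proof.
move=> sH Hx h; split=> [Hh|Hhx]; first exact: subgJ.
by rewrite -(conjgK x h); apply: subgJ => //; apply: subgV.
Qed.

(** If nothing outside [H] normalizes it, [H] absorbs the upper central series: once all [[~ x, g]]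
    lie in [H], [x] normalizes [H] and so belongs to it. *)
Lemma normalizer_grows H : hypercentral G -> subgroup H -> ~ (forall x, H x) ->
  exists x, ~ H x /\ forall h, H h <-> H (h ^ x).
Proof.
move=> hG sH nH; apply: contra_notP nH => /forallNP nn.
apply: (hypercentre_comm_ind hG); first exact: subg1.
move=> x xH; apply: contra_notP (nn x) => nHx; split=> // h.
have Hc : H [~ h, x] by rewrite -invgR; apply: subgV.
have -> : h ^ x = h * [~ h, x] by rewrite commgEl mulVKg.
split=> [Hh|Hhc]; first exact: subgM.
by rewrite -(mulgK [~ h, x] h); apply: subgM => //; apply: subgV.
Qed.

Lemma contranormal_sub K H : contranormal K -> subgroup H -> gsubset K H -> contranormal H.
Proof.
move=> cK sH KH; split=> // x; split=> // _ N nN HN.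
by apply: (contranormalP cK nN) => k /KH/HN.
Qed.

(** The normalizer [M] of a proper [H] is larger and contranormal, so [M = G] by induction on the
    number of classes of [f] not inside [H]; then [H] is normal and equals its normal closure. *)
Lemma contranormal_finidx_whole H : hypercentral G -> contranormal H -> finidx H ->
  forall x, H x.
Proof.
move=> hG cH [F [f fH]].
have [n] := ubnP (pcount (fun c => exists2 x, f x = c & ~ H x) (enum F)).
elim: n H cH fH => // n IH H cH fH; rewrite ltnS => leHn; have sH := cH.1.
apply: contrapT => nH; have [x [nHx xH]] := normalizer_grows hG sH nH.
pose M y := forall h, H h <-> H (h ^ y).
have HM : gsubset H M by move=> y Hy; apply: sub_normalizer.
have sM : subgroup M by apply: normalizer_subgroup.
have allM : forall y, M y.
  apply: (IH M); first exact: contranormal_sub cH sM HM.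
    by move=> y z /fH; apply: HM.
  apply: leq_trans leHn; apply: (@ltn_pcount _ _ _ _ (f x)).
  - by move=> _ [y <- nMy]; exists y => // Hy; apply: nMy; apply: HM.
  - by rewrite mem_enum.
  - by exists x.
  - case=> y /fH Hyx; apply; rewrite -[y](mulgVK x).
    by apply: (subgM sM) => //; apply: HM.
apply: nHx; apply: (contranormalP cH) => //.
by split=> // y g Hy; exact: (proj1 (allM g y) Hy).
Qed.

Lemma finidx_contranormal_prod N K : hypercentral G -> normal N -> finidx N ->
  contranormal K -> forall x, exists n k, [/\ N n, K k & x = n * k].
Proof.
move=> hG nN [F [f fN]] cK; have sN := normal_sub nN; have sK := cK.1.
apply: contranormal_finidx_whole => //; last first.
  exists F, f => x y /fN Nxy; exists (x * y^-1), 1.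
  by rewrite mulg1; split=> //; apply: subg1.
apply: contranormal_sub cK _ _; first exact: prod_subgroup.
by move=> k Kk; exists 1, k; rewrite mul1g; split=> //; apply: subg1.
Qed.

Definition least_finidx V :=
  [/\ normal V, finidx V & forall N, normal N -> finidx N -> gsubset V N].

(* A normal subgroup of finite index is determined among smaller ones by its
   intersection with [K], since it is supplemented by [K]. *)
Lemma least_finidx_exists K : hypercentral G -> contranormal K -> listed K ->
  exists V, least_finidx V.
Proof.
move=> hG cK [l Kl]; have sK := cK.1.
suff main n N : pcount (fun k => K k /\ N k) l < n -> normal N -> finidx N ->
    exists V, least_finidx V.
  apply: (main _ (whole G) (ltnSn _)); first exact: whole_normal.
  by exists unit, (fun=> tt).
elim: n N => // n IH N; rewrite ltnS => leNn nN fN; have sN := normal_sub nN.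
case: (pselect (exists M, [/\ normal M, finidx M & ~ gsubset N M])) => [[M [nM fM nNM]]|nM]; last first.
  by exists N; split=> // M nM' fM; apply: contra_notP nM => nNM; exists M.
have sM := normal_sub nM.
pose L x := N x /\ M x.
have nL : normal L.
  split; last by move=> x g [Nx Mx]; split; apply: normalJ.
  split; first by split; apply: subg1.
  by split=> [x y [Nx Mx] [Ny My]|x [Nx Mx]]; split; [apply: subgM|apply: subgM|apply: subgV|apply: subgV].
have fL : finidx L.
  case: fN fM => [F1 [f1 h1]] [F2 [f2 h2]].
  by exists (F1 * F2)%type, (fun x => (f1 x, f2 x)) => x y [/h1 ? /h2].
have [x [Nx nMx]] : exists x, N x /\ ~ M x.
  by apply: contrapT => /forallNP h; apply: nNM => x Nx; apply: contra_notP (h x).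
(* Since [a] lies in both subgroups, [k] is in [N] but not in [M]: the intersection with [K]
   shrinks. *)
have [a [k [[Na Ma] Kk xE]]] := finidx_contranormal_prod hG nL fL cK x.
apply: (IH L) => //; apply: leq_trans leNn; apply: (@ltn_pcount _ _ _ _ k).
- by move=> y [Ky [Ny _]].
- exact: Kl.
- split=> //; rewrite -(mulKg a k) -xE; apply: subgM => //; exact: subgV.
- by move=> [_ [_ Mk]]; apply: nMx; rewrite xE; apply: subgM.
Qed.

End FiniteIndex.

Lemma im_least_finidx (G Q : AbsGroup) (f : G -> Q) V :
  {morph f : x y / x * y} -> (forall q, exists x, f x = q) ->
  least_finidx V -> least_finidx (im f V).
Proof.
move=> fM fS [nV [F [i iV]] minV]; split.
- exact: im_normal.
- have /choice[r rK] := fS; exists F, (fun q => i (r q)) => x y /iV Vxy.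
  by exists (r x * (r y)^-1); [exact: Vxy|rewrite fM epiV // !rK].
- move=> N nN [F' [j jN]] _ [x Vx <-].
  apply: (minV (fun x => N (f x)) (preim_normal fM nN) _ x Vx).
  by exists F', (fun x => j (f x)) => a b /jN Nab; rewrite fM (epiV fM).
Qed.

(** * Divisibility and commutativity of the least normal subgroup of finite index *)

Section Hyperplane.
Variable G : AbsGroup.
Implicit Types (B W : gsub G) (x y g : G).

(** [B] is maximal among the subgroups of [W] avoiding [a]. For [w] outside [B], adjoining [w]
    captures [a], and solving for [w] places it in the coset of a power of [a]. *)
Lemma elementary_hyperplane W p a : prime p -> subgroup W -> abelian W ->
  (forall w, W w -> w ^+ p = 1) -> W a -> a <> 1 ->
  exists B, [/\ subgroup B, gsubset B W, ~ B a &
    forall w, W w -> exists2 i, i < p & B (w * a ^- i)].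
Proof.
move=> pp sW abW Wp Wa a1.
have cW x y : W x -> W y -> commute x y by move=> ? ?; apply: abW.
(* The empty set is admitted because [Zorn_bigcup] also asks for the union of
   the empty chain. *)
pose P (B : set G) := B = set0 \/ [/\ subgroup B, gsubset B W & ~ B a].
have [|B [PB Bmax]] := @Zorn_bigcup G P.
  move=> C CP totC.
  case: (pselect (exists B, C B /\ B <> set0)) => [[B0 [CB0 B00]]|nC]; last first.
    left; apply/seteqP; split=> // x [B CB Bx]; case: nC; exists B; split=> // B0.
    by rewrite B0 in Bx.
  have CS B x : C B -> B x -> [/\ subgroup B, gsubset B W & ~ B a].
    by move=> /CP[->|].
  right; split.
  - split.
      by exists B0 => //; case: (CP _ CB0) => // -[/subg1].
    split=> [x y [B CB Bx] [B' CB' By]|x [B CB Bx]]; last first.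
      by exists B => //; apply: subgV => //; have [] := CS _ _ CB Bx.
    have [sB _ _] := CS _ _ CB Bx; have [sB' _ _] := CS _ _ CB' By.
    have [BB'|B'B] := totC _ _ CB CB'.
      by exists B' => //; apply: subgM => //; apply: BB'.
    by exists B => //; apply: subgM => //; apply: B'B.
  - by move=> x [B CB Bx]; have [_ BW _] := CS _ _ CB Bx; apply: BW.
  - by move=> [B CB Ba]; have [_ _] := CS _ _ CB Ba.
have {PB} [sB BW nBa] : [/\ subgroup B, gsubset B W & ~ B a].
  case: PB => // B0; case: (Bmax (fun x => x = 1)); last first.
    by right; split; [exact: normal_sub (trivial_normal G) |move=> x ->; exact: subg1|exact: a1].
  by rewrite B0; split=> // /(_ 1 erefl).
exists B; split=> // w Ww.
case: (pselect (B w)) => [Bw|nBw].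
  by exists 0%N; [exact: prime_gt0|rewrite invg1 mulg1].
pose B' x := exists b i, [/\ B b & x = b * w ^+ i].
have sB' : subgroup B'.
  split; first by exists 1, 0%N; split; [exact: subg1|rewrite mulg1].
  split=> [_ _ [b [i [Bb ->]]] [c [j [Bc ->]]]|_ [b [i [Bb ->]]]].
    exists (b * c), (i + j)%N; split; first exact: subgM.
    change (b * w ^+ i * (c * w ^+ j) = b * c * w ^+ (i + j)).
    rewrite expgnDr !mulgA -[b * _ * c]mulgA; congr (_ * _); rewrite -mulgA; congr (_ * _).
    by apply: cW; [apply: subgX|apply: BW].
  exists b^-1, (i * p.-1)%N; split; first exact: subgV.
  change ((b * w ^+ i)^-1 = b^-1 * w ^+ (i * p.-1)); apply: mulg1_eq.
  have -> : b * w ^+ i = w ^+ i * b by apply: cW; [apply: BW|apply: subgX].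
  by rewrite mulgA mulgK -expgnDr -mulnS prednK ?prime_gt0 // mulnC expgnA Wp // expg1n.
have [i Ba] : exists i, B (a * w ^- i).
  apply: contrapT => /forallNP ni; case: (Bmax B').
    split; last by move=> /(_ w) h; apply: nBw; apply: h; exists 1, 1%N; rewrite mul1g; split=> //; exact: subg1.
    by move=> b Bb; exists b, 0%N; rewrite mulg1.
  right; split=> // [_ [b [i [Bb ->]]]|[b [i [Bb aE]]]].
    by apply: subgM => //; [exact: BW|exact: subgX].
  by apply: (ni i); rewrite aE mulgK.
have pNi : ~~ (p %| i).
  by apply: contra_notN nBa => /dvdnP[c iE]; move: Ba; rewrite iE mulnC expgnA Wp // expg1n invg1 mulg1.
have i0 : 0 < i by case: i pNi {Ba}; rewrite ?dvdn0.
(* [c] inverts [i] modulo [p], so the [c]-th power of [a * w ^- i] is [a ^+ c * w^-1]. *)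
case: (egcdnP p i0) => c d cd _.
have cip : gcdn i p = 1%N by apply/eqP; rewrite -/(coprime i p) coprime_sym prime_coprime.
exists (c %% p); first by rewrite ltn_pmod ?prime_gt0.
have -> : a ^+ (c %% p) = a ^+ c.
  by rewrite {2}(divn_eq c p) expgnDr mulnC expgnA Wp // expg1n mul1g.
have wE : w = (w ^+ i) ^+ c.
  by rewrite -expgnA mulnC cd cip expgnDr mulnC expgnA Wp // expg1n mul1g.
have : B ((a * w ^- i) ^+ c)^-1 by apply: subgV => //; apply: subgX.
rewrite expgnFl; first by rewrite invgF -wE.
by apply: cW => //; apply: subgX.
Qed.

(** Otherwise some [B] of index [p] in [W] avoids [a]. As [W] is abelian of finite index, [B] has
    finitely many conjugates; their intersection is normal of finite index without [a], against
    minimality. *)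
Lemma least_finidx_elementary W p : prime p -> least_finidx W -> abelian W ->
  (forall w, W w -> w ^+ p = 1) -> forall w, W w -> w = 1.
Proof.
move=> pp [nW [F [f fW]] minW] abW Wp a Wa; have sW := normal_sub nW.
apply: contrapT => a1.
have [B [sB BW nBa Bi]] := elementary_hyperplane pp sW abW Wp Wa a1.
have /choice[ind hind] : forall w, exists i : 'I_p, W w -> B (w * a ^- i).
  move=> w; case: (pselect (W w)) => [/Bi[i ip Bw]|nWw]; first by exists (Ordinal ip).
  by exists (Ordinal (prime_gt0 pp)).
have /choice[r rE] : forall c : F, exists g : G, (exists x, f x = c) -> f g = c.
  by move=> c; case: (pselect (exists x, f x = c)) => [[x xc]|nx]; [exists x|exists 1].
have {}rE x : f (r (f x)) = f x by apply: rE; exists x.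
pose core x := W x /\ forall g, B (x ^ g).
suff [_ /(_ 1)] : core a by rewrite conjg1.
apply: minW => //.
  split; last first.
    move=> x g [Wx Bx]; split; first exact: normalJ.
    by move=> h; change (B ((x ^ g) ^ h)); rewrite -conjgM.
  split; first by split=> [|g]; rewrite ?conj1g; apply: subg1.
  split=> [x y [Wx Bx] [Wy By]|x [Wx Bx]]; split; [exact: subgM| |exact: subgV|] => g.
    by change (B ((x * y) ^ g)); rewrite conjMg; apply: subgM.
  by change (B (x^-1 ^ g)); rewrite conjVg; apply: subgV.
(* [x * (r (f x))^-1] is the part of [x] in [W]; its conjugate by each representative [r c] is
   recorded modulo [B]. *)
exists (F * {ffun F -> 'I_p})%type.
exists (fun x => (f x, [ffun c => ind ((x * (r (f x))^-1) ^ r c)])) => x y [fxy /ffunP ixy].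
have Wxy := fW _ _ fxy; split=> // g.
set t := r (f x) in ixy; have tE : r (f y) = t by rewrite -fxy.
have Wxt : W (x * t^-1) by apply: fW; rewrite rE.
have Wyt : W (y * t^-1) by apply: fW; rewrite rE.
have {ixy} : ind ((x * t^-1) ^ r (f g)) = ind ((y * t^-1) ^ r (f g)).
  by move: (ixy (f g)); rewrite !ffunE tE.
have gE : g = g * (r (f g))^-1 * r (f g) by rewrite mulgVK.
have Wg : W (g * (r (f g))^-1) by apply: fW; rewrite rE.
set u := r (f g) in gE Wg *; set k := g * u^-1 in gE Wg.
have -> : (x * y^-1) ^ g = (x * t^-1) ^ u * ((y * t^-1) ^ u)^-1.
  rewrite gE conjgM; have -> : (x * y^-1) ^ k = x * y^-1.
    by apply/conjg_fixP/commgP; apply: abW.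
  by rewrite -conjVg -conjMg invgF mulgA mulgVK.
move=> ie; have Bx := hind _ (normalJ u nW Wxt); have By := hind _ (normalJ u nW Wyt).
rewrite -ie in By; rewrite -(mulgKA (a ^- ind ((x * t^-1) ^ u))).
by apply: subgM => //; apply: subgV.
Qed.

End Hyperplane.

(** For a prime [p], the image of [V] modulo its [p]-th powers is elementary abelian and again a
    least subgroup of finite index, hence trivial. *)
Lemma least_finidx_divisible (G : AbsGroup) (V : gsub G) : least_finidx V -> abelian V -> divisible V.
Proof.
move=> lV abV x n Vx n0; suff [y Vy yn] : exists2 y, V y & y ^+ n = x by exists y; rewrite gpowE.
have [nV _ _] := lV; have sV := normal_sub nV.
have prim p z : prime p -> V z -> exists2 y, V y & y ^+ p = z.
  move=> pp Vz; pose A u := exists2 y, V y & y ^+ p = u.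
  have nA : normal A.
    split; last first.
      by move=> _ g [y Vy <-]; exists (y ^ g); [exact: normalJ|rewrite -conjXg].
    split; first by exists 1; [exact: subg1|rewrite expg1n].
    split=> [_ _ [y Vy <-] [w Vw <-]|_ [y Vy <-]].
      by exists (y * w); [exact: subgM|rewrite expgMn //; apply: abV].
    by exists y^-1; [exact: subgV|rewrite expVgn].
  have [Q [f [fM fS fA]]] := quotient_exists nA.
  apply/fA; apply: (least_finidx_elementary pp (im_least_finidx fM fS lV)).
  - by move=> _ _ [u Vu <-] [v Vv <-]; change (f u * f v = f v * f u); rewrite -!fM; congr (f _); apply: abV.
  - by move=> _ [u Vu <-]; rewrite -epiX //; apply/fA; exists u.
  - by exists z.
elim/ltn_ind: n x Vx n0 => n IH x Vx n0.
case: (ltngtP n 1) => [|n1|->]; first by rewrite ltnS leqn0 => /eqP n00; rewrite n00 in n0.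
  have pp := pdiv_prime n1; have pn := pdiv_dvd n.
  have lt : n %/ pdiv n < n by rewrite ltn_Pdiv // prime_gt1.
  have [|y Vy <-] := IH _ lt x Vx; first by rewrite divn_gt0 ?pdiv_gt0 // dvdn_leq.
  have [z Vz <-] := prim _ _ pp Vy; exists z => //.
  by rewrite -expgnA mulnC divnK.
by exists x.
Qed.

(* If [x] in [V] commutes modulo the centre of [V] with all of [G], then
   [V / C_V(x)] is abelian of bounded exponent, while divisible. *)
Lemma least_finidx_abelian (G : AbsGroup) (V : gsub G) : hypercentral G ->
  (forall x : G, exists2 n, 0 < n & x ^+ n = 1) -> least_finidx V -> abelian V.
Proof.
move=> hG tG lV; have [nV _ _] := lV; have sV := normal_sub nV.
suff cen : forall x, V x -> forall y, V y -> commute x y by move=> x y Vx; apply: cen.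
apply: (hypercentre_comm_ind hG) => [_ y _|x IH Vx].
  by apply/commute_sym/commute1.
have cR g y : V y -> commute [~ x, g] y by apply: IH; apply: normalR.
have VR g : V [~ x, g] by apply: normalR.
have xJ g : x ^ g = x * [~ x, g] by rewrite commgEl mulVKg.
pose A y := V y /\ commute x y.
have nA : normal A.
  split; last first.
    move=> y g [Vy xy]; split; first exact: normalJ.
    have e : commute (x ^ g^-1) y.
      by rewrite xJ; apply: commute_sym; apply: commuteM; apply: commute_sym => //; apply: cR.
    have : (x * y ^ g) ^ g^-1 = (y ^ g * x) ^ g^-1.
      by rewrite (conjMg x) (conjMg (y ^ g)) conjgK.
    exact: conjg_inj.
  split; first by split; [exact: subg1|exact: commute1].
  split=> [y z [Vy xy] [Vz xz]|y [Vy xy]]; split; [exact: subgM|exact: commuteM|exact: subgV|exact: commuteV].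
have [Q [f [fM fS fA]]] := quotient_exists nA.
have lQ := im_least_finidx fM fS lV.
(* As [[~ x, y]] centralizes [V], bracketing with [x] is a morphism on [V], with kernel [A]. *)
have xM y z : V y -> V z -> [~ x, y * z] = [~ x, y] * [~ x, z].
  move=> Vy Vz; apply: (mulgI x); rewrite -xJ conjgM xJ conjMg xJ -mulgA.
  have -> : [~ x, y] ^ z = [~ x, y] by apply/conjg_fixP/commgP; apply: cR.
  by congr (_ * _); apply: cR.
have abQ : abelian (im f V).
  move=> _ _ [y Vy <-] [z Vz <-]; change (f y * f z = f z * f y).
  apply: divg1_eq; rewrite -!fM -epiV // -fM; apply/fA; split.
    by apply: subgM; [|apply: subgM|apply: subgV => //; apply: subgM].
  apply/commgP/eqP; rewrite xM; [|exact: subgM|by apply: subgV => //; apply: subgM].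
  have -> : [~ x, y * z] = [~ x, z * y].
    by rewrite !xM //; apply: cR.
  by rewrite -xM ?mulgV ?commg1 //; [exact: subgM|apply: subgV => //; exact: subgM].
have xX y n : V y -> [~ x, y ^+ n] = [~ x, y] ^+ n.
  move=> Vy; elim: n => [|n IHn]; first by rewrite commg1.
  by rewrite !expgS xM ?IHn //; apply: subgX.
have [n n0 xn] := tG x; move=> y Vy.
(* Modulo [A], [y] is [u ^+ n]; and [[~ x, u] ^+ n = 1] because [x] and [x ^ u] both have trivial
   [n]-th power. *)
have [_ [[u Vu <-] fu]] := least_finidx_divisible lQ abQ (ex_intro2 _ _ y Vy erefl) n0.
suff /fA[_ //] : f y = 1.
rewrite -fu gpowE -epiX //; apply/fA; split; first exact: subgX.
apply/commgP/eqP; rewrite xX //.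
have : (x ^ u) ^+ n = 1 by rewrite -conjXg xn conj1g.
by rewrite xJ expgMn ?xn ?mul1g //; apply/commute_sym/cR.
Qed.


(** * Finite subgroups and abelian normal subgroups *)

Section FiniteSubgroup.
Variable G : AbsGroup.
Implicit Types (K : gsub G) (x k : G).

Lemma expg_coprime x a b : x ^+ a = 1 -> x ^+ b = 1 -> coprime a b -> x = 1.
Proof.
case: a => [_ + /eqP|a xa xb /eqP cab]; first by rewrite gcd0n => + b1; rewrite b1 expg1.
case: (@egcdnP a.+1 b) => // c d e _; rewrite cab in e.
have := expgnDr x (d * b) 1; rewrite -e mulnC expgnA xa expg1n mulnC expgnA xb.
by rewrite expg1n mul1g expg1.
Qed.

Lemma finite_subgroup_order K k : subgroup K -> listed K -> K k ->
  exists2 n, 0 < n & k ^+ n = 1.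
Proof.
move=> sK [l Kl] Kk; pose t := [seq k ^+ i | i <- iota 0 (size l).+1].
have : ~~ uniq t.
  apply: contraT; rewrite negbK => ut.
  have /(uniq_leq_size ut) : {subset t <= l} by move=> _ /mapP[i _ ->]; apply: Kl; apply: subgX.
  by rewrite size_map size_iota ltnn.
case/(uniqPn 1) => i [j [ij]]; rewrite size_map size_iota => jl.
have il := ltn_trans ij jl.
rewrite !(nth_map 0%N) ?size_iota // !nth_iota // !add0n => e.
exists (j - i)%N; first by rewrite subn_gt0.
by rewrite expgnFr ?(ltnW ij) // e mulgV.
Qed.

(** Taking for [m] the product of the orders of all elements makes Cauchy's theorem unnecessary: a
    prime dividing [m] divides the order of some [k], and a power of [k] has order [p]. *)
Lemma finite_subgroup_exponent K : subgroup K -> listed K ->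
  exists2 m, 0 < m & (forall k, K k -> k ^+ m = 1) /\
    forall p, prime p -> p %| m -> exists k, [/\ K k, k <> 1 & k ^+ p = 1].
Proof.
move=> sK fK; have [l Kl] := fK.
have /choice[o oP] : forall k, exists n, K k -> [/\ 0 < n, k ^+ n = 1 &
    forall i, 0 < i -> k ^+ i = 1 -> n <= i].
  move=> k; case: (pselect (K k)) => [Kk|]; last by exists 0%N.
  have ex : exists n, (0 < n) && (k ^+ n == 1).
    by have [n n0 kn] := finite_subgroup_order sK fK Kk; exists n; rewrite n0; apply/eqP.
  exists (ex_minn ex) => _; case: ex_minnP => n /andP[n0 /eqP kn] nmin; split=> // i i0 ki.
  by apply: nmin; rewrite i0; apply/eqP.
pose s := [seq k <- l | `[< K k >]].
have sP k : reflect (K k) (k \in s).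
  rewrite mem_filter; apply: (iffP andP) => [[/asboolP]//|Kk].
  by split; [apply/asboolP|apply: Kl].
exists (\prod_(k <- s) o k)%N; last split.
- rewrite big_seq; elim/big_ind: _ => // [a b|k /sP/oP[] //].
  by rewrite muln_gt0 => -> ->.
- move=> k /[dup] /oP[o0 ko _] /sP ks.
  suff /dvdnP[c ->] : o k %| \prod_(k <- s) o k by rewrite mulnC expgnA ko expg1n.
  by rewrite (big_rem k) //= dvdn_mulr.
- move=> p pp; rewrite big_seq; elim/big_ind: _ => [|a b IHa IHb|k /sP Kk /dvdnP[c okE]].
  + by rewrite dvdn1 => /eqP p1; rewrite p1 in pp.
  + by rewrite Euclid_dvdM // => /orP[/IHa|/IHb].
  have [o0 ko omin] := oP _ Kk; exists (k ^+ c); split; first exact: subgX.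
    have c0 : 0 < c by move: o0; rewrite okE muln_gt0 => /andP[].
    move/(omin _ c0); rewrite okE leqNgt ltn_Pmulr //; exact: prime_gt1.
  by rewrite -expgnA -okE.
Qed.

End FiniteSubgroup.

Section NormalAbelian.
Variables (G : AbsGroup) (V : gsub G) (nV : normal V) (abV : abelian V).

Definition abelian_normal_type of normal V & abelian V := {x : G | V x}.
Local Notation U := (abelian_normal_type nV abV).

HB.instance Definition _ := gen_eqMixin U.
HB.instance Definition _ := gen_choiceMixin U.

Let sV := normal_sub nV.
Definition uval (u : U) : G := sval u.

Lemma uvalP (u : U) : V (uval u). Proof. exact: svalP. Qed.

Lemma uval_inj : injective uval.
Proof. by move=> [x Vx] [y Vy] xy; apply: eq_exist. Qed.

Definition usub x (Vx : V x) : U := exist _ x Vx.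
Definition uadd (u v : U) := usub (subgM sV (uvalP u) (uvalP v)).
Definition uopp (u : U) := usub (subgV sV (uvalP u)).
Definition uzero := usub (subg1 sV).
Definition uact g (u : U) := usub (normalJ g nV (uvalP u)).

Fact uaddA : associative uadd.
Proof. by move=> u v w; apply: uval_inj; apply: mulgA. Qed.
Fact uaddC : commutative uadd.
Proof. by move=> u v; apply: uval_inj; apply: abV; apply: uvalP. Qed.
Fact uadd0 : left_id uzero uadd.
Proof. by move=> u; apply: uval_inj; apply: mul1g. Qed.
Fact uaddN : left_inverse uzero uopp uadd.
Proof. by move=> u; apply: uval_inj; apply: mulVg. Qed.

HB.instance Definition _ := GRing.isZmodule.Build U uaddA uaddC uadd0 uaddN.

Lemma uvalD (u v : U) : uval (u + v)%R = uval u * uval v. Proof. by []. Qed.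
Lemma uvalN (u : U) : uval (- u)%R = (uval u)^-1. Proof. by []. Qed.
Lemma uvalJ g (u : U) : uval (uact g u) = uval u ^ g. Proof. by []. Qed.

Lemma uvalMn (u : U) n : uval (u *+ n)%R = uval u ^+ n.
Proof. by elim: n => [|n IH] //; rewrite mulrS expgS uvalD IH. Qed.

Lemma uactB g u v : uact g (u - v)%R = (uact g u - uact g v)%R.
Proof. by apply: uval_inj; rewrite uvalJ !(uvalD, uvalN) conjMg conjVg. Qed.

Lemma uact1 u : uact 1 u = u.
Proof. by apply: uval_inj; rewrite uvalJ conjg1. Qed.

Lemma uactM g h u : uact (g * h) u = uact h (uact g u).
Proof. by apply: uval_inj; rewrite !uvalJ conjgM. Qed.

Lemma uact_abelian v g u : V v -> uact (v * g) u = uact g u.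
Proof.
move=> Vv; rewrite uactM; congr (uact _ _); apply: uval_inj; rewrite uvalJ.
by apply/conjg_fixP/commgP; apply: abV; first exact: uvalP.
Qed.

End NormalAbelian.

Lemma In_mem (T : eqType) (x : T) (l : seq T) : In x l <-> x \in l.
Proof.
elim: l => [|y l IH] //=; rewrite inE; split=> [[->|/IH->]|/orP[/eqP->|/IH]].
- by rewrite eqxx.
- by rewrite orbT.
- by left.
- by right.
Qed.

Lemma finite_set_listed (G : AbsGroup) (X : gsub G) : finite_set X <-> listed X.
Proof. by split=> -[l Xl]; exists l => x /Xl/In_mem. Qed.

Lemma listed_inj (T U : eqType) (f : T -> U) (X : T -> Prop) : injective f ->
  listed (fun y => exists2 x, X x & f x = y) -> listed X.
Proof.
move=> fi [l Xl].
apply: listed_sub (@listed_bigU _ _ l (fun y x => f x = y) _) => [x Xx|y _].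
  by exists (f x) => //; apply: Xl; exists x.
case: (pselect (exists x, f x = y)) => [[x xy]|nx]; last by exists [::] => x xy; case: nx; exists x.
by exists [:: x] => z; rewrite -xy => /fi->; rewrite mem_head.
Qed.

Lemma gen_subgroup (G : AbsGroup) (S : gsub G) : subgroup (gen S).
Proof.
split=> [H [] //|]; split=> [x y gx gy H sH SH|x gx H sH SH].
  by apply: subgM => //; [apply: gx|apply: gy].
by apply: subgV => //; apply: gx.
Qed.

Lemma mem_gen (G : AbsGroup) (S : gsub G) x : S x -> gen S x.
Proof. by move=> Sx H _; apply. Qed.

Section CommutatorSubgroup.
Variables (G : AbsGroup) (V K : gsub G).
Hypotheses (nV : normal V) (abV : abelian V) (cK : contranormal K) (fK : listed K).
Hypothesis VK : forall x : G, exists v k, [/\ V v, K k & x = v * k].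

Lemma commsub_sub (D : gsub G) : normal D -> gsubset (commsub D K) D.
Proof.
move=> nD x; apply; first exact: normal_sub.
by move=> _ [d [k [Dd [_ ->]]]]; apply: normalR.
Qed.

Lemma commsub_mem v k : V v -> K k -> commsub V K [~ v, k].
Proof. by move=> Vv Kk; apply: mem_gen; exists v, k. Qed.

(** [V] centralizes [[V, K]], which it contains, while [K] permutes the generators. *)
Lemma commsub_normal : normal (commsub V K).
Proof.
have sK := cK.1; have sW : subgroup (commsub V K) := gen_subgroup _; split=> //.
move=> x g Wx; change (commsub V K (x ^ g)).
apply: (Wx (fun x => commsub V K (x ^ g))).
  split; first by rewrite conj1g; apply: (subg1 sW).
  split=> [y z Wy Wz|y Wy].
    by change (commsub V K ((y * z) ^ g)); rewrite conjMg; apply: (subgM sW).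
  by change (commsub V K (y^-1 ^ g)); rewrite conjVg; apply: (subgV sW).
move=> _ [v [k [Vv [Kk ->]]]]; change (commsub V K ([~ v, k] ^ g)).
have [u [h [Vu Kh ->]]] := VK g; rewrite conjgM.
have -> : [~ v, k] ^ u = [~ v, k] by apply/conjg_fixP/commgP; apply: abV => //; apply: normalR.
by rewrite conjRg; apply: commsub_mem; [apply: normalJ|apply: subgJ].
Qed.

(* [V, K] K is normal since [K^v <= [V, K] K]; so [V, K] has finite index. *)
Lemma least_finidx_commsub : least_finidx V -> seteq (commsub V K) V.
Proof.
move=> [_ _ minV] x; split; first exact: commsub_sub.
have sK := cK.1; have nW := commsub_normal; have sW := normal_sub nW.
have sP := prod_subgroup nW sK; set P := (X in subgroup X) in sP.
have KP : gsubset K P by move=> k Kk; exists 1, k; rewrite mul1g; split=> //; apply: subg1.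
have WP : gsubset (commsub V K) P by move=> w Ww; exists w, 1; rewrite mulg1; split=> //; apply: subg1.
have allP : forall y, P y.
  apply: (contranormalP cK _ KP); split=> // _ g [w [k [Ww Kk ->]]].
  change (P ((w * k) ^ g)); rewrite conjMg; apply: (subgM sP).
    by apply: WP; apply: (normalJ g nW).
  have [v [h [Vv Kh ->]]] := VK g; rewrite conjgM; apply: (subgJ sP); last exact: KP.
  have -> : k ^ v = k * [~ v, k]^-1 by rewrite invgR commgEl mulVKg.
  apply: (subgM sP); first exact: KP.
  by apply: WP; apply: (subgV sW); apply: commsub_mem.
have /choice[c cP] : forall y, exists k, K k /\ commsub V K (y * k^-1).
  by move=> y; have [w [k [Ww Kk ->]]] := allP y; exists k; rewrite mulgK.
have [l Kl] := fK; apply: minV => //.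
(* [y] is sent to the position in [l] of its factor in [K]; equal factors mean a difference in
   [[V, K]]. *)
exists 'I_(size l).+1, (fun y => inord (index (c y) l)) => y z.
move/(congr1 (@nat_of_ord _)); rewrite !inordK ?ltnS ?index_size // => yz.
have {}yz : c y = c z.
  by rewrite -(nth_index 1 (Kl _ (cP y).1)) yz nth_index //; apply: Kl; apply: (cP z).1.
rewrite -(mulgKA (c y)^-1) {2}yz; apply: (subgM sW); first exact: (cP y).2.
by apply: (subgV sW); apply: (cP z).2.
Qed.

End CommutatorSubgroup.

(** * From subgroups of the additive copy of [V] to subgroups of [G] *)

Section Transfer.
Variables (G : AbsGroup) (V : gsub G) (nV : normal V) (abV : abelian V).
Local Notation U := (abelian_normal_type nV abV).
Implicit Types (D : U -> Prop).

Definition lift_sub D : gsub G := fun x => exists2 u : U, D u & uval u = x.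

Lemma lift_subV D : gsubset (lift_sub D) V.
Proof. by move=> _ [u _ <-]; apply: uvalP. Qed.

Lemma lift_sub_subgroup D : asubg D -> subgroup (lift_sub D).
Proof.
move=> sD; split; first by exists 0%R => //; case: sD.
split=> [_ _ [u Du <-] [v Dv <-]|_ [u Du <-]].
  by exists (u + v)%R; first exact: asubgD.
by exists (- u)%R; first exact: asubgN.
Qed.

Lemma lift_sub_normal D : asubg D -> invariant (@uact G V nV abV) D -> normal (lift_sub D).
Proof.
move=> sD iD; split; first exact: lift_sub_subgroup.
by move=> _ g [u Du <-]; exists (uact g u); first exact: iD.
Qed.

Lemma restrict_asubg (H : gsub G) : subgroup H -> asubg (fun u : U => H (uval u)).
Proof.
move=> sH; split; first exact: subg1.
by move=> u v Hu Hv; rewrite uvalD uvalN; apply: subgM => //; apply: subgV.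
Qed.

Lemma lift_quasifinite D : aquasifinite (@uact G V nV abV) D -> quasifinite (lift_sub D).
Proof.
move=> [sD iD dD infD qD]; split; first exact: lift_sub_normal.
split; first by move=> x y /lift_subV Vx /lift_subV Vy; apply: abV.
split.
  by move=> /finite_set_listed fD; apply: infD; apply: listed_inj fD; apply: uval_inj.
move=> B nB BD [_ [[u Du <-] nBu]].
have [|||l hl] := qD (fun u => B (uval u)) (restrict_asubg (normal_sub nB)).
- by move=> g v Bv; rewrite uvalJ; apply: normalJ.
- by move=> v /BD[w Dw /uval_inj<-].
- by exists u.
apply/finite_set_listed; exists (map (@uval G V nV abV) l) => x /[dup] /BD[v Dv <-] Bv.
by apply: map_f; apply: hl.
Qed.

End Transfer.

Theorem theoremC (G : AbsGroup) :
  hypercentral G ->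
  (exists K : gsub G, subgroup K /\ finite_set K /\ contranormal K) ->
  exists (V C : gsub G),
    (* (i) *)
    normal V /\ abelian V /\ divisible V /\
    subgroup C /\ finite_set C /\ contranormal C /\
    seteq (prodset V C) (whole G) /\
    (* (ii) *)
    (forall p, Pi (whole G) p <-> Pi C p) /\
    (exists l : list nat, forall p, Pi (whole G) p -> In p l) /\
    (* (iii) and (iv) *)
    exists (M : Type) (D : M -> gsub G),
      (forall mu, gsubset (D mu) V /\ quasifinite (D mu)) /\
      seteq V (gen (fun x => exists mu, D mu x)) /\
      (forall mu, seteq (commsub (D mu) C) (D mu)) /\
      seteq (commsub V C) V.
Proof.
move=> hG [K [sK [/[dup] finK /finite_set_listed fK cK]]].
have [m m0 [Km Kp]] := finite_subgroup_exponent sK fK.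
have tm := contranormal_torsion m0 hG cK Km.
have tG (x : G) : exists2 n, 0 < n & x ^+ n = 1.
  by have [j xj] := tm x; exists (m ^ j)%N; first by rewrite expn_gt0 m0.
have [V lV] := least_finidx_exists hG cK fK.
have [nV fV _] := lV; have sV := normal_sub nV.
have abV := least_finidx_abelian hG tG lV.
have dV := least_finidx_divisible lV abV.
have VK := finidx_contranormal_prod hG nV fV cK.
have WV := least_finidx_commsub nV abV cK fK VK lV.
have Pim p : Pi (whole G) p -> prime p /\ p %| m.
  move=> [pp [x [_ [x1 xp]]]]; split=> //; have [j xj] := tm x.
  apply: contrapT => /negP npm; apply: x1; apply: (expg_coprime (a := p) _ xj).
    by rewrite -gpowE.
  by rewrite coprimeXr // prime_coprime.
pose U := abelian_normal_type nV abV; pose act := @uact G V nV abV.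
have [l Kl] := fK; pose s := undup [seq k <- l | `[< K k >]].
have sP k : reflect (K k) (k \in s).
  rewrite mem_undup mem_filter; apply: (iffP andP) => [[/asboolP]//|Kk].
  by split; [apply/asboolP|apply: Kl].
have us : uniq s by apply: undup_uniq.
have s1 : 1 \in s by apply/sP; exact: subg1.
have sM g h : g \in s -> h \in s -> g * h \in s.
  by move=> /sP Kg /sP Kh; apply/sP; apply: subgM.
have sact g : exists2 k, k \in s & act g =1 act k.
  have [v [k [Vv Kk ->]]] := VK g; exists k; first exact/sP.
  by move=> u; apply: uact_abelian.
have tU : torsion U.
  move=> u; have [n n0 un] := tG (uval u); exists n => //.
  by apply: uval_inj; rewrite uvalMn.
have dU : adivisible (fun _ : U => True).
  move=> u n _ n0; have [y [Vy yn]] := dV _ _ (uvalP u) n0.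
  by exists (usub nV abV Vy) => //; apply: uval_inj; rewrite uvalMn -yn gpowE.
have nm (u : U) : (\sum_(k <- s) act k u = 0)%R.
  (* Elements of norm zero form a subgroup containing each [act h w - w], since translating by [h]
     permutes the sum; these generate [[V, K] = V]. *)
  have sN : asubg (fun u : U => \sum_(k <- s) act k u = 0)%R.
    split=> [|v w v0 w0].
      by apply: big1 => k _; apply: uval_inj; rewrite uvalJ; apply: conj1g.
    by rewrite (eq_bigr _ (fun k _ => uactB k v w)) sumrB v0 w0 subrr.
  have [_ /(_ (uvalP u))/(_ _ (lift_sub_subgroup sN))] := WV (uval u).
  case=> [|v v0 /uval_inj <- //].
  move=> _ [v [h [Vv [Kh ->]]]]; exists (- usub nV abV Vv + act h (usub nV abV Vv))%R => //.
  set w := usub _ _ _; rewrite addrC (eq_bigr _ (fun k _ => uactB k _ w)) sumrB.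
  apply/eqP; rewrite subr_eq0; apply/eqP/esym.
  rewrite (sum_reindex us (h := fun k => h * k)); first by apply: eq_bigr => k _; apply: uactM.
    exact: mulgI.
  by move=> k ks; apply: sM => //; apply/sP.
exists V, K; do 6![split; first by []].
split.
  move=> x; split=> // _; have [v [k [Vv Kk ->]]] := VK x; by exists v, k.
split.
  move=> p; split=> [/Pim[pp /(Kp p pp)[k [Kk k1 kp]]]|[pp [x [_ x1p]]]].
    by split=> //; exists k; rewrite gpowE.
  by split=> //; exists x.
split; first by exists (primes m) => p /Pim[pp pm]; apply/In_mem; rewrite mem_primes pp m0.
(* The family consists of all divisible quasifinite subgroups of [V], with no decomposition
   chosen. *)
exists {D : U -> Prop | aquasifinite act D}, (fun D => lift_sub (sval D)).
split; first by move=> [D qD]; split; [exact: lift_subV|exact: lift_quasifinite].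
split.
  move=> x; split=> [Vx|]; last by apply=> // y [mu]; apply: lift_subV.
  have := aquasifinite_span_full (@uactB G V nV abV) (@uact1 G V nV abV) (@uactM G V nV abV)
    us s1 sM sact tU dU (usub nV abV Vx).
  move=> /(_ (fun u => gen _ (uval u)) (restrict_asubg nV abV (gen_subgroup _))).
  apply=> D qD u Du; apply: mem_gen.
  by exists (exist _ D qD), u.
split=> // -[D qD] x; have [sD iD _ _ _] := qD.
have nD := lift_sub_normal sD iD.
split; first exact: commsub_sub.
move=> [u Du <-].
have := aquasifinite_commutators (@uactB G V nV abV) (@uactM G V nV abV) s1 sM sact tU nm qD
  (restrict_asubg nV abV (gen_subgroup _)); apply=> // k d /sP Kk Dd.
(* [act k d - d] is the commutator [[~ d, k]] written additively. *)
rewrite addrC; apply: mem_gen; exists (uval d), k; split; first by exists d.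
by split.
Qed.
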